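(* On the Euler graph, let $\mu$ be an ergodic probability measure on the path space such that for every $n$, $\mathcal{L}(\varepsilon_n\mid V_{n-1})=\mathcal{L}(\varepsilon_n\mid\mathcal{G}_{n-1})$. Then the filtration $\mathcal{G}$ admits a generating parameterization; hence it is standard.
   Context: Euler graph: at each level $n\le0$ vertices $0,\dots,|n|$; vertex $v$ at level $n$ is connected to vertex $v$ at level $n-1$ by $v+1$ edges and to vertex $v+1$ at level $n-1$ by $|n|+1-v$ edges. Edges from a given vertex of level $n-1$ to level $n$ carry distinct labels. For a random path, $V_n$ is its vertex at level $n$ and $\varepsilon_n$ the label of its edge joining $V_{n-1}$ to $V_n$; $\mathcal G$ is the filtration generated by $(V_n,\varepsilon_n)_{n\le0}$, $\mathcal G_n=\sigma(V_m,\varepsilon_m;m\le n)$. $\mu$ is ergodic if $\bigcap_n\mathcal G_n$ is trivial. Parameterization of $\mathcal G$: $(U_n)$ with $U_n$ independent of $\mathcal G_{n-1}\vee\sigma(U_m;m\le n-1)$ and $\mathcal G_n\subset\mathcal G_{n-1}\vee\sigma(U_n)$; generating if $\mathcal G_n\subset\sigma(U_m;m\le n)$ for all $n$ (up to isomorphism). Standard: up to isomorphism, immersed in a filtration generated by independent random variables. *)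

(* Defs.v *)
From HB Require Import structures.
From mathcomp Require Import all_boot all_order all_algebra.
From mathcomp Require Import all_classical all_reals all_analysis.

Set Implicit Arguments.
Unset Strict Implicit.
Unset Printing Implicit Defensive.

Import Order.TTheory GRing.Theory Num.Theory.
Local Open Scope classical_set_scope.
Local Open Scope ring_scope.

(* Indexing convention: level n <= 0 of the Euler graph is encoded by k = -n : nat.
   For a path w:
     V k w  = V_{-k}(w), the vertex at level -k (in 0..k);
     J k w  = the index (0-based) of the edge used between V_{-k-1} and V_{-k}
              among the (multiple) edges joining these two vertices.
   The label eps_{-k} of the edge joining V_{-k-1} to V_{-k} is encoded by the
   pair (V k, J k); pairs are distinct for distinct edges leaving V_{-k-1}
   upwards, so this is a legitimate labelling. *)

(* Validity of a path of the Euler graph: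
   vertex v at level -k is joined to vertex v at level -k-1 by v+1 edges and
   to vertex v+1 at level -k-1 by k+1-v edges. *)
Definition euler_path (v j : nat -> nat) : Prop :=
  forall k : nat, (v k <= k)%N /\
    ((v k.+1 = v k /\ (j k < (v k).+1)%N) \/
     (v k.+1 = (v k).+1 /\ (j k < k.+1 - v k)%N)).

Definition proc_gen (T : Type) (V J : nat -> T -> nat) (k : nat) : set (set T) :=
  [set A | exists i a, (k <= i)%N /\
      (A = V i @^-1` [set a] \/ A = J i @^-1` [set a])].

Definition Gfilt (T : Type) (V J : nat -> T -> nat) (k : nat) : set (set T) :=
  <<s proc_gen V J k >>.

Definition proc_measurable d (T : measurableType d) (V J : nat -> T -> nat) :=
  (forall k a, measurable (V k @^-1` [set a])) /\
  (forall k a, measurable (J k @^-1` [set a])).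

Definition euler_process (T : Type) (V J : nat -> T -> nat) :=
  forall w : T, euler_path (fun k => V k w) (fun k => J k w).

Section defs.
Context {R : realType}.

Definition symdiff (T : Type) (A B : set T) : set T := (A `\` B) `|` (B `\` A).

Definition ergodic d (T : measurableType d) (P : probability T R)
  (V J : nat -> T -> nat) : Prop :=
  forall A, (forall k, Gfilt V J k A) -> P A = 0%E \/ P A = 1%E.

(* L(eps_n | V_{n-1}) = L(eps_n | G_{n-1}) for every n, i.e. (V_{n-1} being
   discrete) eps_n and G_{n-1} are conditionally independent given V_{n-1}:
   P(A, V_{n-1}=w, eps_n=e) P(V_{n-1}=w) = P(A, V_{n-1}=w) P(V_{n-1}=w, eps_n=e)
   for every A in G_{n-1}. With n = -k, V_{n-1} = V k.+1, G_{n-1} = Gfilt k.+1,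
   eps_n = (V k, J k). *)
Definition cond_law_hyp d (T : measurableType d) (P : probability T R)
  (V J : nat -> T -> nat) : Prop :=
  forall (k : nat) (A : set T) (w v e : nat), Gfilt V J k.+1 A ->
    let Vw := V k.+1 @^-1` [set w] in
    let Ee := V k @^-1` [set v] `&` J k @^-1` [set e] in
    (P (A `&` Vw `&` Ee) * P Vw = P (A `&` Vw) * P (Vw `&` Ee))%E.

Definition same_law d (T : measurableType d) (P : probability T R)
  (V J : nat -> T -> nat) d' (T' : measurableType d') (P' : probability T' R)
  (V' J' : nat -> T' -> nat) : Prop :=
  forall (N : nat) (a b : nat -> nat),
    P [set x | forall k, (k < N)%N -> V k x = a k /\ J k x = b k] =
    P' [set x | forall k, (k < N)%N -> V' k x = a k /\ J' k x = b k].

Definition sigma_rv (T : Type) dU (E : measurableType dU) (U : T -> E)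
  : set (set T) := [set A | exists B, measurable B /\ A = U @^-1` B].

Definition gen_filt (T : Type) dU (E : measurableType dU) (U : nat -> T -> E)
  (k : nat) : set (set T) :=
  <<s [set A | exists i B, (k <= i)%N /\ measurable B /\ A = U i @^-1` B] >>.

Definition subset_mod d (T : measurableType d) (P : probability T R)
  (F1 F2 : set (set T)) : Prop :=
  forall A, F1 A -> exists B, F2 B /\ P (symdiff A B) = 0%E.

Definition generating_param d (T : measurableType d) (P : probability T R)
  (V J : nat -> T -> nat) dU (E : measurableType dU) (U : nat -> T -> E) : Prop :=
  (forall k, measurable_fun setT (U k)) /\
  (forall k A B, <<s Gfilt V J k.+1 `|` gen_filt U k.+1 >> A -> measurable B ->
      P (A `&` U k @^-1` B) = (P A * P (U k @^-1` B))%E) /\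
  (forall k, subset_mod P (Gfilt V J k)
                          <<s Gfilt V J k.+1 `|` sigma_rv (U k) >>) /\
  (forall k, subset_mod P (Gfilt V J k) (gen_filt U k)).

Definition has_generating_parameterization d (T : measurableType d)
  (P : probability T R) (V J : nat -> T -> nat) : Prop :=
  exists d' (T' : measurableType d') (P' : probability T' R)
         (V' J' : nat -> T' -> nat),
    euler_process V' J' /\ proc_measurable V' J' /\
    same_law P V J P' V' J' /\
    exists dU (E : measurableType dU) (U : nat -> T' -> E),
      generating_param P' V' J' U.

Definition indep_family d (T : measurableType d) (P : probability T R)
  dU (E : measurableType dU) (W : nat -> T -> E) : Prop :=
  (forall k, measurable_fun setT (W k)) /\
  forall (s : seq nat) (B : nat -> set E), uniq s ->
    (forall i, measurable (B i)) ->
    P (\bigcap_(i in [set` s]) (W i @^-1` B i)) =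
    (\prod_(i <- s) P (W i @^-1` B i))%E.

(* immersion of the filtration Gf in Ff (index k <-> time -k):
   Gf_n is included in Ff_n (up to null sets), and for every A in Gf_{n+1}
   the conditional probability P(A | Ff_n) has a Gf_n-measurable version Y,
   i.e. P(A | Ff_n) = P(A | Gf_n); this is equivalent to every Gf-martingale
   being an Ff-martingale. *)
Definition immersed d (T : measurableType d) (P : probability T R)
  (Gf Ff : nat -> set (set T)) : Prop :=
  (forall k, subset_mod P (Gf k) (Ff k)) /\
  (forall k A, Gf k A ->
     exists Y : T -> R, (forall x, 0 <= Y x <= 1) /\
       (forall b : R, Gf k.+1 [set x | Y x <= b]) /\
       (forall B, Ff k.+1 B -> P (A `&` B) = (\int[P]_(x in B) (Y x)%:E)%E)).

Definition standard d (T : measurableType d) (P : probability T R)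
  (V J : nat -> T -> nat) : Prop :=
  exists d' (T' : measurableType d') (P' : probability T' R)
         (V' J' : nat -> T' -> nat),
    euler_process V' J' /\ proc_measurable V' J' /\
    same_law P V J P' V' J' /\
    exists dW (E : measurableType dW) (W : nat -> T' -> E),
      indep_family P' W /\ immersed P' (Gfilt V' J') (gen_filt W).

End defs.

(* Main.v *)
(* V moves by at most one unit per step (in direct time it stays or decreases by
   one), so any coupling of the one-step transitions started from the different
   states preserves the order of the states. Enlarge the space and let U_k be a
   random table assigning to every state w of level k+1 an edge leaving w: the
   edge actually used when w = V_(k+1), and independent edges with the
   conditional laws given V_(k+1) = w otherwise. U_k is then independent of the
   past. If two copies are driven by the same U's from states v <= w of a remote
   level N, the probability that V_k >= a for exactly one of them is the
   difference of the conditional probabilities given V_N = v and V_N = w. By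
   ergodicity P(V_k >= a | V_N) converges to P(V_k >= a) in probability, so a
   copy started from a well chosen constant state, which is a function of the
   U's alone, is close to V_k. *)
Require Import Defs.
From HB Require Import structures.
From mathcomp Require Import all_boot all_order all_algebra.
From mathcomp Require Import all_classical all_reals all_analysis.
From mathcomp Require Import measurable_realfun ring lra zify.

Set Implicit Arguments.
Unset Strict Implicit.
Unset Printing Implicit Defensive.

Import Order.TTheory GRing.Theory Num.Theory.
Local Open Scope classical_set_scope.
Local Open Scope ring_scope.

(** * Generated sigma-algebras and real-valued probabilities *)

Section generated.
Context {T : Type}.
Implicit Types (G H : set (set T)) (A B : set T).

Lemma sigma_genP G H : H set0 -> (forall A, H A -> H (~` A)) ->
  (forall F : nat -> set T, (forall n, H (F n)) -> H (\bigcup_n F n)) ->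
  G `<=` H -> <<s G >> `<=` H.
Proof.
move=> H0 HC HU GH; apply: smallest_sub => //.
by split => // A HA; rewrite setTD; apply: HC.
Qed.

Lemma sigma_genC G A : <<s G >> A -> <<s G >> (~` A).
Proof. by move=> GA; rewrite -setTD; apply: sigma_algebraCD. Qed.

Lemma sigma_genT G : <<s G >> [set: T].
Proof. by have := sigma_genC (@sigma_algebra0 _ setT G); rewrite setC0. Qed.

Lemma sigma_genU G A B : <<s G >> A -> <<s G >> B -> <<s G >> (A `|` B).
Proof.
move=> GA GB; rewrite -bigcup2E; apply: sigma_algebra_bigcup => -[|[|i]] //=.
exact: sigma_algebra0.
Qed.

Lemma sigma_genI G A B : <<s G >> A -> <<s G >> B -> <<s G >> (A `&` B).
Proof.
move=> GA GB; rewrite -[A `&` B]setCK setCI.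
by apply: sigma_genC; apply: sigma_genU; apply: sigma_genC.
Qed.

Lemma sigma_genD G A B : <<s G >> A -> <<s G >> B -> <<s G >> (A `\` B).
Proof. by move=> GA GB; rewrite setDE; apply: sigma_genI => //; apply: sigma_genC. Qed.

(** Measurability by cases on a countably valued variable: the event is the union over [n] of the
    pieces on which [f] equals [n]. Events that read a process or a table at a random state are
    handled this way. *)
Lemma sigma_gen_fiber G (f : T -> nat) (E : nat -> set T) :
  (forall n, <<s G >> (f @^-1` [set n])) -> (forall n, <<s G >> (E n)) ->
  <<s G >> [set x | E (f x) x].
Proof.
move=> Gf GE; rewrite (_ : mkset _ = \bigcup_n (f @^-1` [set n] `&` E n)).
  by apply: sigma_algebra_bigcup => n; apply: sigma_genI.
apply/seteqP; split=> [x Ex|x [n _ [/= <-]]] //.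
by exists (f x).
Qed.

Lemma sigma_gen_cst G (Q : Prop) : <<s G >> [set _ | Q].
Proof.
have [q|q] := pselect Q.
  by rewrite (_ : mkset _ = setT); [exact: sigma_genT|apply/seteqP; split].
by rewrite (_ : mkset _ = set0); [exact: sigma_algebra0|apply/seteqP; split].
Qed.

Lemma sigma_gen_preimage G (f : T -> nat) (S : set nat) :
  (forall n, <<s G >> (f @^-1` [set n])) -> <<s G >> (f @^-1` S).
Proof.
move=> Gf; apply: (@sigma_gen_fiber G f (fun n => [set _ | S n])) => // n.
exact: sigma_gen_cst.
Qed.

End generated.

Lemma sigma_gen_measurable d (T : measurableType d) (G : set (set T)) :
  G `<=` measurable -> <<s G >> `<=` measurable.
Proof.
move=> Gm; apply: sigma_genP => //.
- by move=> A; exact: measurableC.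
- by move=> F; exact: bigcupT_measurable.
Qed.

Lemma measurable_preimage_nat d (T : measurableType d) (f : T -> nat) S :
  (forall n, measurable (f @^-1` [set n])) -> measurable (f @^-1` S).
Proof.
move=> mf; rewrite (_ : _ @^-1` _ = \bigcup_(n in S) f @^-1` [set n]).
  exact: bigcup_measurable.
by apply/seteqP; split=> [x Sx|x [n Sn /= fx]]; [exists (f x)|rewrite /preimage /= fx].
Qed.

Section real_probability.
Context {R : realType} d (T : measurableType d) (P : probability T R).
Implicit Types (A B : set T).

Definition pr A : R := fine (P A).

Lemma prE A : measurable A -> P A = (pr A)%:E.
Proof. by move=> mA; rewrite /pr fineK// fin_num_measure. Qed.

Lemma pr_ge0 A : 0 <= pr A.
Proof. exact: fine_ge0. Qed.

Lemma pr_le1 A : measurable A -> pr A <= 1.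
Proof. by move=> mA; rewrite -lee_fin -prE// probability_le1. Qed.

Lemma pr0 : pr set0 = 0.
Proof. by rewrite /pr measure0. Qed.

Lemma prT : pr setT = 1.
Proof. by rewrite /pr probability_setT. Qed.

Lemma pr_le A B : measurable A -> measurable B -> A `<=` B -> pr A <= pr B.
Proof. by move=> mA mB AB; rewrite -lee_fin -!prE// le_measure// inE. Qed.

Lemma prDI A B : measurable A -> measurable B ->
  pr A = pr (A `\` B) + pr (A `&` B).
Proof.
move=> mA mB; apply: EFin_inj; rewrite EFinD -!prE//.
- exact: measureDI.
- exact: measurableI.
- exact: measurableD.
Qed.

Lemma prC A : measurable A -> pr (~` A) = 1 - pr A.
Proof.
move=> mA; rewrite -prT (prDI measurableT mA) setTD setTI; lra.
Qed.

Lemma prU_le A B : measurable A -> measurable B -> pr (A `|` B) <= pr A + pr B.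
Proof.
move=> mA mB; rewrite -lee_fin EFinD -!prE//; first exact: measureU2.
exact: measurableU.
Qed.

(** Countable additivity over the fibres of [f]. Comparisons of probabilities are thereby reduced to
    events on which a discrete variable, typically a state or a table, is frozen. *)
Lemma pr_fiber_le (f : T -> nat) A B (a b : R) :
  (forall n, measurable (f @^-1` [set n])) ->
  measurable A -> measurable B ->
  0 <= a -> 0 <= b ->
  (forall n, a * pr (A `&` f @^-1` [set n]) <= b * pr (B `&` f @^-1` [set n])) ->
  a * pr A <= b * pr B.
Proof.
move=> mf mA mB a0 b0 le; rewrite -lee_fin !EFinM -!prE//.
have dec C : measurable C -> P C = (\sum_(n <oo) P (C `&` f @^-1` [set n]))%E.
  move=> mC; have {1}-> : C = \bigcup_n (C `&` f @^-1` [set n]).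
    apply/seteqP; split=> [x Cx|x [n _ []]] //.
    by exists (f x).
  apply: measure_semi_bigcup.
  - by move=> n; apply: measurableI.
  - by move=> i j _ _ [x [[_ /= <-] [_ /= <-]]].
  - by apply: bigcupT_measurable => n; apply: measurableI.
rewrite (dec _ mA) (dec _ mB) -!nneseriesZl; last 2 first.
- by move=> i _; exact: measure_ge0.
- by move=> i _; exact: measure_ge0.
apply: lee_nneseries => [i _ _|n _].
  by apply: mule_ge0 => //; rewrite lee_fin.
by rewrite !prE -?EFinM ?lee_fin//; apply: measurableI.
Qed.

Lemma pr_fiber (f : T -> nat) A B (a b : R) :
  (forall n, measurable (f @^-1` [set n])) ->
  measurable A -> measurable B ->
  0 <= a -> 0 <= b ->
  (forall n, a * pr (A `&` f @^-1` [set n]) = b * pr (B `&` f @^-1` [set n])) ->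
  a * pr A = b * pr B.
Proof.
move=> mf mA mB a0 b0 e; apply/eqP; rewrite eq_le.
by apply/andP; split; apply: (pr_fiber_le mf) => // n; rewrite e.
Qed.

Lemma pr_fiber_sum (f : T -> nat) (b : nat) A :
  (forall n, measurable (f @^-1` [set n])) -> measurable A ->
  (forall x, A x -> (f x < b)%N) ->
  pr A = \sum_(n < b) pr (A `&` f @^-1` [set nat_of_ord n]).
Proof.
move=> mf mA fb.
have mS S : measurable (f @^-1` S) by exact: measurable_preimage_nat.
transitivity (pr (A `&` f @^-1` [set n | (n < b)%N])).
  by congr pr; apply/seteqP; split=> [x Ax|x []] //; split=> //; exact: fb.
elim: b {fb} => [|b IH].
  by rewrite big_ord0 (_ : _ `&` _ = set0) ?pr0//; apply/seteqP; split=> x // -[].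
rewrite big_ord_recr /= -IH addrC.
rewrite (prDI (measurableI _ _ mA (mS _)) (mS [set b])) addrC.
congr (pr _ + pr _); apply/seteqP; split=> x; rewrite /setI /setD /preimage /=.
- by move=> [[Ax fb] nb]; split=> //; lia.
- by move=> [Ax fb]; split; [split=> //|]; lia.
- by move=> [[Ax fb] nb].
- by move=> [Ax ->].
Qed.

Lemma pr_bigcup_gt (F : nat -> set T) (c : R) :
  (forall n, measurable (F n)) -> {homo F : m n / (m <= n)%N >-> m `<=` n} ->
  c < pr (\bigcup_n F n) -> exists n, c < pr (F n).
Proof.
move=> mF ndF cF; have mU := bigcupT_measurable F mF.
apply: contrapT => /forallNP nc.
have : nondecreasing_seq F by move=> m n mn; apply/subsetPset; exact: ndF.
move=> /(nondecreasing_cvg_mu (mu := P) mF mU) cv.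
have : (P (\bigcup_n F n) <= c%:E)%E.
  rewrite -(cvg_lim _ cv)//; apply: lime_le; first by apply/cvg_ex; eexists; exact: cv.
  by apply: nearW => n /=; rewrite prE// lee_fin leNgt; apply/negP; exact: nc.
by rewrite prE// lee_fin leNgt cF.
Qed.

End real_probability.

(** * Remote events *)

Section filtrations.
Context {T : Type} (V J : nat -> T -> nat) dE (E : measurableType dE)
  (U : nat -> T -> E).

Lemma Gfilt_V k i a : (k <= i)%N -> Gfilt V J k (V i @^-1` [set a]).
Proof. by move=> ki; apply: sub_sigma_algebra; exists i, a; split=> //; left. Qed.

Lemma Gfilt_J k i a : (k <= i)%N -> Gfilt V J k (J i @^-1` [set a]).
Proof. by move=> ki; apply: sub_sigma_algebra; exists i, a; split=> //; right. Qed.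

Lemma Gfilt_le k l : (k <= l)%N -> Gfilt V J l `<=` Gfilt V J k.
Proof.
move=> kl; apply: sub_sigma_algebra2 => A [i [a [li ?]]].
by exists i, a; split=> //; exact: leq_trans li.
Qed.

Lemma gen_filt_U k i B : (k <= i)%N -> measurable B ->
  gen_filt U k (U i @^-1` B).
Proof. by move=> ki mB; apply: sub_sigma_algebra; exists i, B. Qed.

Lemma gen_filt_le k l : (k <= l)%N -> gen_filt U l `<=` gen_filt U k.
Proof.
move=> kl; apply: sub_sigma_algebra2 => A [i [B [li ?]]].
by exists i, B; split=> //; exact: leq_trans li.
Qed.

(** The past of the path and of the tables together: a parameterization must be independent of this
    larger past. *)
Definition joint_filt k := <<s Gfilt V J k `|` gen_filt U k >>.

Lemma Gfilt_joint k : Gfilt V J k `<=` joint_filt k.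
Proof. by move=> A GA; apply: sub_sigma_algebra; left. Qed.

Lemma gen_filt_joint k : gen_filt U k `<=` joint_filt k.
Proof. by move=> A GA; apply: sub_sigma_algebra; right. Qed.

Lemma joint_filt_le k l : (k <= l)%N -> joint_filt l `<=` joint_filt k.
Proof.
move=> kl; apply: sub_sigma_algebra2 => A [GA|UA].
  by left; exact: Gfilt_le GA.
by right; exact: gen_filt_le UA.
Qed.

End filtrations.

Lemma Gfilt_measurable d (T : measurableType d) (V J : nat -> T -> nat) k :
  proc_measurable V J -> Gfilt V J k `<=` measurable.
Proof.
by move=> [mV mJ]; apply: sigma_gen_measurable => A [i [a [_ [->|->]]]].
Qed.

Lemma gen_filt_measurable d (T : measurableType d) (U : nat -> T -> nat) k :
  (forall i a, measurable (U i @^-1` [set a])) -> gen_filt U k `<=` measurable.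
Proof.
move=> mU; apply: sigma_gen_measurable => A [i [B [_ [_ ->]]]].
exact: measurable_preimage_nat.
Qed.

Lemma joint_filt_measurable d (T : measurableType d) (V J U : nat -> T -> nat) k :
  proc_measurable V J -> (forall i a, measurable (U i @^-1` [set a])) ->
  joint_filt V J U k `<=` measurable.
Proof.
move=> mVJ mU; apply: sigma_gen_measurable => A [|].
  exact: Gfilt_measurable.
exact: gen_filt_measurable.
Qed.

Section last_exit.
Context {R : realType} d (T : measurableType d) (P : probability T R)
  (V J : nat -> T -> nat).
Hypothesis mVJ : proc_measurable V J.
Hypothesis erg : ergodic P V J.

Let mG k A : Gfilt V J k A -> measurable A.
Proof. exact: Gfilt_measurable. Qed.

(* Decomposing the union of the B_m, m < M, according to the largest m (the
   earliest time) at which B_m occurs gives c P(union) <= P(A); if the B_m did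
   not become small, their limsup would have probability one. *)
Lemma last_exit (k : nat) (A : set T) (c : R) (B : nat -> set T) :
  measurable A -> pr P A < c ->
  (forall m, Gfilt V J (k + m) (B m)) ->
  (forall m D, Gfilt V J (k + m) D -> D `<=` B m ->
     c * pr P D <= pr P (A `&` D)) ->
  forall e : R, 0 < e -> exists N, forall m, (N <= m)%N -> pr P (B m) < e.
Proof.
move=> mA Ac GB cD e e0; apply: contrapT => /forallNP often.
have mB m : measurable (B m) := mG (GB m).
have c0 : 0 < c by apply: le_lt_trans Ac; exact: pr_ge0.
pose W M := [set x | exists2 m, (m < M)%N & B m x].
have WS M : W M.+1 = W M `|` B M.
  apply/seteqP; split=> x.
    move=> [m]; rewrite ltnS leq_eqVlt => /orP[/eqP-> Bx|mM Bx].
      by right.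
    by left; exists m.
  by move=> [[m mM Bx]|Bx]; [exists m => //; exact: ltnW|exists M].
have mW M : measurable (W M).
  elim: M => [|M IH]; last by rewrite WS; exact: measurableU.
  by rewrite (_ : W 0%N = set0)//; apply/seteqP; split=> x // [].
(* The auxiliary event [C] makes the induction possible: on [B M] the path is charged to the index
   [M], and off it the smaller event obtained by removing [B M] from [C] is passed on to [W M]. *)
have exitW M C : Gfilt V J (k + M) C ->
    c * pr P (C `&` W M) <= pr P (A `&` (C `&` W M)).
  elim: M C => [|M IH] C GC.
    rewrite (_ : W 0%N = set0) ?setI0 ?pr0 ?mulr0//.
    by apply/seteqP; split=> x // [].
  have {}GC : Gfilt V J (k + M) C by apply: Gfilt_le GC; rewrite addnS.
  have mC := mG GC.
  have mCW : measurable (C `&` W M.+1) by exact: measurableI.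
  rewrite (prDI P mCW (mB M)) [leRHS](prDI P _ (mB M)); last exact: measurableI.
  have -> : C `&` W M.+1 `&` B M = C `&` B M.
    by rewrite WS; apply/seteqP; split=> x; rewrite /setI /setU /setD /=; tauto.
  have -> : A `&` (C `&` W M.+1) `&` B M = A `&` (C `&` B M).
    by rewrite WS; apply/seteqP; split=> x; rewrite /setI /setU /setD /=; tauto.
  have -> : A `&` (C `&` W M.+1) `\` B M = A `&` ((C `\` B M) `&` W M).
    by rewrite WS; apply/seteqP; split=> x; rewrite /setI /setU /setD /=; tauto.
  have -> : (C `&` W M.+1) `\` B M = (C `\` B M) `&` W M.
    by rewrite WS; apply/seteqP; split=> x; rewrite /setI /setU /setD /=; tauto.
  rewrite mulrDr lerD//; first by apply: IH; exact: (sigma_genD GC (GB M)).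
  by apply: cD; [exact: (sigma_genI GC (GB M))|exact: subIsetr].
pose S n := \bigcup_m B (n + m)%N.
(* [S n] involves only indices from [n] on, so the limsup [L] lies in every [Gfilt V J j] and the
   zero-one law applies to it. *)
have GS j n : (j <= k + n)%N -> Gfilt V J j (S n).
  move=> jn; apply: sigma_algebra_bigcup => m.
  by apply: Gfilt_le (GB (n + m)%N); lia.
have mS n : measurable (S n) by exact: mG (GS 0%N n _).
pose L := \bigcap_n S n.
have S_le m n : (m <= n)%N -> S n `<=` S m.
  by move=> mn x [i _ Bx]; exists (n - m + i)%N => //; rewrite addnA subnKC.
have GL j : Gfilt V J j L.
  rewrite (_ : L = ~` \bigcup_n ~` S (j + n)%N).
    apply: sigma_genC; apply: sigma_algebra_bigcup => n; apply: sigma_genC.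
    by apply: GS; lia.
  rewrite setC_bigcup; apply/seteqP; split=> x Lx n _.
    by rewrite setCK; exact: Lx.
  by apply: (@S_le n (j + n)%N); [exact: leq_addl|rewrite -[S _]setCK; exact: Lx].
have S_ge n : e <= pr P (S n).
  have /existsNP[m /not_implyP[nm /negP]] := often n.
  rewrite -leNgt => /le_trans; apply; apply: pr_le => // x Bx.
  by exists (m - n)%N => //; rewrite subnKC.
have mL : measurable L := mG (GL 0%N).
have L_ge : e <= pr P L.
  rewrite leNgt; apply/negP => Le.
  have : 1 - e < pr P (\bigcup_n ~` S n).
    rewrite -setC_bigcap prC//; lra.
  move=> /pr_bigcup_gt[].
  - by move=> n; exact: measurableC.
  - by move=> m n mn; apply: subsetC; exact: S_le.
  by move=> n; rewrite prC//; have := S_ge n; lra.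
have L1 : pr P L = 1.
  rewrite /pr; case: (erg GL) => [L0|->//].
  by move: L_ge; rewrite /pr L0 /=; lra.
(* The ratio is below one and the increasing events [W M] cover [L], which has probability one. Some
   finite [W M] therefore contradicts [exitW] taken with the full space. *)
have : pr P A / c < pr P (\bigcup_M W M).
  apply: (@lt_le_trans _ _ 1); first by rewrite ltr_pdivrMr ?mul1r.
  rewrite -L1; apply: pr_le => //; first exact: bigcupT_measurable.
  by move=> x /(_ 0%N I)[m _ Bx]; exists m.+1 => //; exists m.
move=> /pr_bigcup_gt[] //.
  by move=> m n mn x [i im Bx]; exists i => //; exact: leq_trans mn.
move=> M; rewrite ltr_pdivrMr// mulrC; apply/negP; rewrite -leNgt.
have := exitW M setT (@sigma_genT _ _); rewrite setTI => /le_trans; apply.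
by apply: pr_le => //; exact: measurableI.
Qed.

End last_exit.

(** * Approximation of events up to null sets *)

Lemma measurable_symdiff d (T : measurableType d) (A B : set T) :
  measurable A -> measurable B -> measurable (symdiff A B).
Proof. by move=> mA mB; apply: measurableU; exact: measurableD. Qed.

(** Borel-Cantelli: approximants with summable errors are chosen, and their limsup differs from [A]
    by a null set. *)
Lemma ae_eq_approx {R : realType} d (T : measurableType d) (P : probability T R)
    (F : set (set T)) (A : set T) :
  <<s F >> `<=` measurable -> measurable A ->
  (forall e : R, 0 < e -> exists2 B, <<s F >> B & pr P (symdiff A B) <= e) ->
  exists B, <<s F >> B /\ P (symdiff A B) = 0%E.
Proof.
move=> mF mA approx.
have /choice[B HB] (n : nat) : exists B, <<s F >> B /\
    pr P (symdiff A B) <= 1 / (2 ^ n.+1)%:R.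
  have [|B FB le] := approx (1 / (2 ^ n.+1)%:R).
    by rewrite divr_gt0// ltr0n expn_gt0.
  by exists B.
have FB n : <<s F >> (B n) by have [] := HB n.
have mX n : measurable (symdiff A (B n)).
  by apply: measurable_symdiff => //; exact: mF.
have FL : <<s F >> (lim_sup_set B).
  rewrite /lim_sup_set -[X in <<s F >> X]setCK setC_bigcap.
  apply: sigma_genC; apply: sigma_algebra_bigcup => n; apply: sigma_genC.
  rewrite bigcup_mkcond; apply: sigma_algebra_bigcup => m.
  by case: ifP => // _; exact: (@sigma_algebra0 _ setT).
exists (lim_sup_set B); split=> //.
apply: (@subset_measure0 _ _ _ P _ (lim_sup_set (fun n => symdiff A (B n)))).
- exact: measurable_symdiff (mF _ FL).
- by apply: bigcapT_measurable => n; exact: bigcup_measurable.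
- move=> x [[Ax nL] n _|[Lx nAx] n _].
    apply: contrapT => nX; apply: nL => m _.
    exists (maxn m n); first by rewrite /= leq_maxl.
    apply: contrapT => nB; apply: nX; exists (maxn m n); first by rewrite /= leq_maxr.
    by left.
  by have [m nm Bx] := Lx n I; exists m => //; right.
- apply: lim_sup_set_cvg0 => //.
  apply: (@le_lt_trans _ _ 1%:E); last exact: ltry.
  apply: le_trans (epsilon_trick0 xpredT ler01).
  apply: lee_nneseries => // n _.
  by have [_] := HB n; rewrite -lee_fin -(prE P (mX n)).
Qed.

(** * Processes driven by independent tables *)

Section driven_process.
Context {R : realType} d (T : measurableType d) (P : probability T R)
  (V J U : nat -> T -> nat) (step : nat -> nat -> nat -> nat).
Hypothesis mVJ : proc_measurable V J.
Hypothesis mU : forall k a, measurable (U k @^-1` [set a]).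
(** The number [step k n w] codes the edge that table [n] assigns to state [w] of level [k.+1]: its
    parity tells whether the state drops by one, its half is the index of the edge. *)
Hypothesis V_step : forall k x,
  V k x = (V k.+1 x - odd (step k (U k x) (V k.+1 x)))%N.
Hypothesis J_step : forall k x, J k x = (step k (U k x) (V k.+1 x))./2.
Hypothesis indepU : forall k n A, joint_filt V J U k.+1 A ->
  pr P (A `&` U k @^-1` [set n]) = pr P A * pr P (U k @^-1` [set n]).

Let mG k A : Gfilt V J k A -> measurable A.
Proof. exact: Gfilt_measurable. Qed.

Let mUf k A : gen_filt U k A -> measurable A.
Proof. exact: gen_filt_measurable. Qed.

Let mH k A : joint_filt V J U k A -> measurable A.
Proof. exact: joint_filt_measurable. Qed.

Let mV k a : measurable (V k @^-1` [set a]).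
Proof. by case: mVJ. Qed.

Let mJ k a : measurable (J k @^-1` [set a]).
Proof. by case: mVJ. Qed.

Lemma driver_independent k A (B : set nat) : joint_filt V J U k.+1 A ->
  P (A `&` U k @^-1` B) = (P A * P (U k @^-1` B))%E.
Proof.
move=> HA; have mA := mH HA.
have mUB : measurable (U k @^-1` B) by exact: measurable_preimage_nat.
rewrite !prE//; last exact: measurableI.
rewrite -EFinM; congr (_%:E); rewrite -[LHS]mul1r.
apply: (pr_fiber (mU k)) => //; first exact: measurableI; first exact: pr_ge0.
move=> n; rewrite mul1r; have [Bn|nBn] := pselect (B n).
  have -> : U k @^-1` B `&` U k @^-1` [set n] = U k @^-1` [set n].
    by apply/seteqP; split=> [x []|x /= Ux] //; split=> //; rewrite /= Ux.
  rewrite -setIA.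
  have -> : U k @^-1` B `&` U k @^-1` [set n] = U k @^-1` [set n].
    by apply/seteqP; split=> [x []|x /= Ux] //; split=> //; rewrite /= Ux.
  exact: indepU.
rewrite -setIA (_ : U k @^-1` B `&` U k @^-1` [set n] = set0).
  by rewrite setI0 pr0 mulr0.
by apply/seteqP; split=> x // -[/= Bx Ux]; apply: nBn; rewrite -Ux.
Qed.

Lemma driver_indep_family : indep_family P U.
Proof.
split=> [k _ B _|s B us _]; first by rewrite setTI; exact: measurable_preimage_nat.
(* Sorting puts the smallest index, that is the latest level, first; the events of all the other
   indices then lie in the past of its table. *)
have -> : \bigcap_(i in [set` s]) U i @^-1` B i =
          \bigcap_(i in [set` sort leq s]) U i @^-1` B i.
  by apply/seteqP; split=> x Hx i /=; [rewrite mem_sort|rewrite -(mem_sort leq)]; exact: Hx.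
rewrite (perm_big (sort leq s)) /=; last by rewrite perm_sym perm_sort.
have : sorted ltn (sort leq s) by rewrite ltn_sorted_uniq_leq sort_uniq us sort_sorted//; exact: leq_total.
move: (sort leq s) => {us}s.
have gen_cap k (t : seq nat) : {in t, forall i, (k <= i)%N} ->
    gen_filt U k (\bigcap_(i in [set` t]) U i @^-1` B i).
  move=> kt; rewrite bigcap_mkcond -[X in gen_filt U k X]setCK setC_bigcap.
  apply: sigma_genC; apply: sigma_algebra_bigcup => i; apply: sigma_genC.
  case: ifPn => [/set_mem /= it|_]; last exact: sigma_genT.
  exact: gen_filt_U (kt _ it) _.
elim: s => [|k s IH] ks.
  by rewrite big_nil set_nil bigcap_set0 probability_setT.
have -> : \bigcap_(i in [set` k :: s]) U i @^-1` B i =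
          \bigcap_(i in [set` s]) U i @^-1` B i `&` U k @^-1` B k.
  apply/seteqP; split=> [x Hx|x [Hx Hk] i /=].
    by split=> [i is_|]; apply: Hx; rewrite /= inE ?eqxx// is_ orbT.
  by rewrite inE => /orP[/eqP->//|]; exact: Hx.
rewrite big_cons driver_independent ?IH//.
- by rewrite muleC.
- exact: path_sorted ks.
- apply: gen_filt_joint; apply: gen_cap => i.
  by move: ks => /= /(order_path_min ltn_trans) /allP; exact.
Qed.

Lemma V_driven k a : <<s Gfilt V J k.+1 `|` sigma_rv (U k) >> (V k @^-1` [set a]).
Proof.
pose E n := V k.+1 @^-1` [set v | (v - odd (step k n v))%N = a].
rewrite (_ : _ @^-1` _ = [set x | E (U k x) x]); last first.
  by apply/seteqP; split=> x; rewrite /E /preimage /= (V_step k).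
apply: (@sigma_gen_fiber _ _ (U k) E) => n.
  by apply: sub_sigma_algebra; right; exists [set n].
apply: sigma_gen_preimage => v.
by apply: sub_sigma_algebra; left; exact: Gfilt_V.
Qed.

Lemma J_driven k a : <<s Gfilt V J k.+1 `|` sigma_rv (U k) >> (J k @^-1` [set a]).
Proof.
pose E n := V k.+1 @^-1` [set v | (step k n v)./2 = a].
rewrite (_ : _ @^-1` _ = [set x | E (U k x) x]); last first.
  by apply/seteqP; split=> x; rewrite /E /preimage /= (J_step k).
apply: (@sigma_gen_fiber _ _ (U k) E) => n.
  by apply: sub_sigma_algebra; right; exists [set n].
apply: sigma_gen_preimage => v.
by apply: sub_sigma_algebra; left; exact: Gfilt_V.
Qed.

Lemma Gfilt_driven k : Gfilt V J k `<=` <<s Gfilt V J k.+1 `|` sigma_rv (U k) >>.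
Proof.
apply: sigma_genP.
- exact: (@sigma_algebra0 _ setT).
- by move=> A; exact: sigma_genC.
- by move=> F; exact: sigma_algebra_bigcup.
move=> A [i [a [ki HA]]]; move: ki; rewrite leq_eqVlt => /orP[/eqP ki|ki].
  by subst i; case: HA => ->; [exact: V_driven|exact: J_driven].
by apply: sub_sigma_algebra; left; case: HA => ->; [exact: Gfilt_V|exact: Gfilt_J].
Qed.

(** The state reached at level [k] by obeying the tables from state [w] at level [k + m]. As [w]
    need not be the actual state, this is a copy of the process driven by the same noise. *)
Fixpoint run k m w x : nat :=
  if m is m'.+1
  then run k m' (w - odd (step (k + m') (U (k + m') x) w))%N x else w.

Lemma run_V k m x : run k m (V (k + m) x) x = V k x.
Proof.
elim: m => [|m IH] /=; first by rewrite addn0.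
by rewrite addnS -V_step.
Qed.

(* From w < w' one step leads to at most w, resp. at least w' - 1, so that
   running all initial states with the same driving noise is a monotone
   coupling, whatever the joint law of the steps out of w and w'. *)
Lemma run_le k m w w' x : (w <= w')%N -> (run k m w x <= run k m w' x)%N.
Proof.
elim: m w w' => [|m IH] w w' //= ww'; apply: IH.
move: ww'; rewrite leq_eqVlt => /orP[/eqP->//|ww'].
by case: (odd _); case: (odd _) => /=; lia.
Qed.

Definition run_ge k m w a := [set x | (a <= run k m w x)%N].

Lemma run_ge_gen k m w a : gen_filt U k (run_ge k m w a).
Proof.
elim: m w => [|m IH] w; first exact: (@sigma_gen_cst _ _ (a <= w)%N).
apply: (@sigma_gen_fiber _ _ (U (k + m))
    (fun n => run_ge k m (w - odd (step (k + m) n w))%N a)) => n.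
  by apply: gen_filt_U => //; exact: leq_addr.
exact: IH.
Qed.

Let mrun k m w a : measurable (run_ge k m w a).
Proof. exact: (mUf (@run_ge_gen k m w a)). Qed.

(** Induction on [m]: once the remotest table is frozen, the first step is deterministic and a
    shorter run starts from a fixed state, while the value of that table joins the past event
    [C]. *)
Lemma run_ge_independent k m w a C : joint_filt V J U (k + m) C ->
  pr P (C `&` run_ge k m w a) = pr P C * pr P (run_ge k m w a).
Proof.
elim: m w C => [|m IH] w C HC.
  rewrite /run_ge /=; case: (a <= w)%N.
    by rewrite (_ : mkset _ = setT) ?setIT ?prT ?mulr1//; apply/seteqP; split.
  by rewrite (_ : mkset _ = set0) ?setI0 ?pr0 ?mulr0//; apply/seteqP; split.
have mC := mH HC.
rewrite -[LHS]mul1r; apply: (pr_fiber (mU (k + m))) => //.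
- exact: measurableI.
- exact: pr_ge0.
move=> n; rewrite mul1r.
have runS : run_ge k m.+1 w a `&` U (k + m) @^-1` [set n] =
    U (k + m) @^-1` [set n] `&` run_ge k m (w - odd (step (k + m) n w))%N a.
  apply/seteqP; split=> x [].
    by move=> Hr /= Ux; split=> //; move: Hr; rewrite /run_ge /= Ux.
  by move=> /= Ux Hr; split=> //; rewrite /run_ge /= Ux.
rewrite runS -setIA runS.
have HU : joint_filt V J U (k + m) (U (k + m) @^-1` [set n]).
  by apply: gen_filt_joint; exact: gen_filt_U.
rewrite setIA !IH//; first by rewrite indepU -?addnS// mulrA.
apply: sigma_genI => //; apply: joint_filt_le HC; lia.
Qed.

(** Started from the actual state, [run] is the process itself. Hence [pr P (run_ge k m v a)] acts
    as the conditional probability of [a <= V k] given [V (k + m) = v], whatever else is known of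
    the past of the path. *)
Lemma run_ge_Markov k m v a D : Gfilt V J (k + m) D ->
  pr P ([set x | (a <= V k x)%N] `&` D `&` V (k + m) @^-1` [set v]) =
  pr P (D `&` V (k + m) @^-1` [set v]) * pr P (run_ge k m v a).
Proof.
move=> GD; rewrite -run_ge_independent; last first.
  by apply: Gfilt_joint; apply: sigma_genI => //; exact: Gfilt_V.
congr (pr P _); apply/seteqP; split=> x /=; rewrite /run_ge /=.
  by move=> [[aV Dx] <-]; rewrite run_V.
by move=> [[Dx <-]]; rewrite run_V.
Qed.

(** * Ergodicity: the path is a function of the tables *)

Hypothesis erg : ergodic P V J.

Let mVge k a : measurable [set x | (a <= V k x)%N].
Proof. exact: (@measurable_preimage_nat _ _ (V k) [set n | (a <= n)%N]). Qed.

(** Deviations above and below are treated separately by [last_exit], the thresholds [c + e] and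
    [1 - c + e] being strictly above the probabilities of [A] and of its complement. Each deviation
    is allotted [e / 2]. *)
Lemma run_ge_concentration k a (e : R) : 0 < e -> exists N, forall m, (N <= m)%N ->
  pr P [set x | e <= `|pr P (run_ge k m (V (k + m) x) a) -
                       pr P [set x | (a <= V k x)%N]| ] < e.
Proof.
move=> e0; set A := [set x | (a <= V k x)%N]; set c := pr P A.
have mA : measurable A := mVge k a.
pose p m w := pr P (run_ge k m w a).
pose B1 m := [set x | c + e <= p m (V (k + m) x)].
pose B2 m := [set x | p m (V (k + m) x) <= c - e].
have e20 : 0 < e / 2 by lra.
have [||m D GD DB|N1 H1] := @last_exit _ _ _ P _ _ mVJ erg k A (c + e) B1
    (mVge k a) _ _ _ _ e20; rewrite -/c.
- by lra.
- move=> m; apply: (@sigma_gen_preimage _ _ (V (k + m)) [set w | c + e <= p m w]).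
  by move=> n; exact: Gfilt_V.
- have mD := mG GD; rewrite -[leRHS]mul1r.
  apply: (pr_fiber_le (mV (k + m))) => //; first exact: measurableI.
    by rewrite addr_ge0 ?pr_ge0 ?ltW.
  move=> v; rewrite mul1r run_ge_Markov// mulrC.
  have [->|/set0P[x [Dx Vx]]] := eqVneq (D `&` V (k + m) @^-1` [set v]) set0.
    by rewrite pr0 !mul0r.
  by apply: ler_wpM2l; [exact: pr_ge0|rewrite -Vx; exact: DB].
have [||m D GD DB|N2 H2] := @last_exit _ _ _ P _ _ mVJ erg k (~` A) (1 - c + e) B2
    (measurableC (mVge k a)) _ _ _ _ e20; rewrite ?prC -/c//.
- by lra.
- move=> m; apply: (@sigma_gen_preimage _ _ (V (k + m)) [set w | p m w <= c - e]).
  by move=> n; exact: Gfilt_V.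
- have mD := mG GD; rewrite -[leRHS]mul1r.
  have c1 : c <= 1 by exact: pr_le1.
  apply: (pr_fiber_le (mV (k + m))) => //.
  + by apply: measurableI => //; exact: measurableC.
  + by lra.
  move=> v; rewrite mul1r.
  have mDv : measurable (D `&` V (k + m) @^-1` [set v]) by exact: measurableI.
  have := prDI P mDv mA; rewrite [_ `&` A]setIC setIA run_ge_Markov//.
  have -> : (D `&` V (k + m) @^-1` [set v]) `\` A =
      ~` A `&` D `&` V (k + m) @^-1` [set v].
    by apply/seteqP; split=> x; rewrite /setI /setD /=; tauto.
  have [->|/set0P[x [Dx Vx]]] := eqVneq (D `&` V (k + m) @^-1` [set v]) set0.
    by rewrite pr0 mul0r addr0 mulr0 => <-.
  set q := pr P (_ `&` _) => Hq; have q0 : 0 <= q by exact: pr_ge0.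
  have := DB _ Dx; rewrite /B2 /= Vx -/(p m v) in Hq * => pc; nra.
exists (maxn N1 N2) => m; rewrite geq_max => /andP[/H1 lt1 /H2 lt2].
have mB1 : measurable (B1 m).
  by apply: (@measurable_preimage_nat _ _ (V (k + m)) [set w | c + e <= p m w]).
have mB2 : measurable (B2 m).
  by apply: (@measurable_preimage_nat _ _ (V (k + m)) [set w | p m w <= c - e]).
apply: (@le_lt_trans _ _ (pr P (B1 m `|` B2 m))); last first.
  by apply: le_lt_trans (prU_le P mB1 mB2) _; lra.
apply: pr_le; last 1 first.
- move=> x /=; rewrite ler_normr => /orP[] H; [left|right]; rewrite /B1 /B2 /= /p; lra.
- by apply: (@measurable_preimage_nat _ _ (V (k + m)) [set w | e <= `|p m w - c|]).
- exact: measurableU.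
Qed.

Lemma symdiff_run_ge k m v w a C (e : R) : joint_filt V J U (k + m) C ->
  `|pr P (run_ge k m v a) - pr P (run_ge k m w a)| <= e ->
  pr P (symdiff (run_ge k m v a) (run_ge k m w a) `&` C) <= e * pr P C.
Proof.
move=> HC; have mC := mH HC.
wlog vw : v w / (v <= w)%N.
  move=> H; case: (leqP v w) => [|/ltnW] vw; first exact: H.
  by rewrite distrC /symdiff setUC; exact: H.
have sub : run_ge k m v a `<=` run_ge k m w a.
  by move=> x /leq_trans; apply; exact: run_le.
have -> : symdiff (run_ge k m v a) (run_ge k m w a) `&` C =
    (C `&` run_ge k m w a) `\` run_ge k m v a.
  apply/seteqP; split=> x; rewrite /symdiff /setI /setU /setD /=.
    by have := sub x; tauto.
  by tauto.
have := prDI P (measurableI _ _ mC (mrun k m w a)) (mrun k m v a).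
rewrite -setIA (setIidr sub) !run_ge_independent// => H.
have := pr_ge0 P C => C0 /ler_normlP[le1 le2]; nra.
Qed.

Lemma V_ge_approx k a (e : R) : 0 < e ->
  exists2 B, gen_filt U k B & pr P (symdiff [set x | (a <= V k x)%N] B) <= e.
Proof.
move=> e0; set A := [set x | (a <= V k x)%N].
(* The error will be at most [2 * f] on the good states plus [f] on [Bad], whence [e / 3]. The bound
   [1 / 2] keeps [Bad] from being the whole space, so that a good state exists. *)
pose f := Num.min (e / 3) (1 / 2).
have f0 : 0 < f by rewrite lt_min; apply/andP; split; lra.
have f3 : f <= e / 3 by rewrite ge_min lexx.
have f1 : f <= 1 / 2 by rewrite ge_min lexx orbT.
have [N /(_ N (leqnn N))] := run_ge_concentration k a f0.
pose p w := pr P (run_ge k N w a); rewrite -/A.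
set Bad := [set x | _ <= _] => Bad_f.
have mBad : measurable Bad.
  by apply: (@measurable_preimage_nat _ _ (V (k + N)) [set w | f <= `|p w - pr P A|]).
have [x0 good] : exists x, ~ Bad x.
  apply: contrapT => /forallNP bad; move: Bad_f.
  rewrite (_ : Bad = setT) ?prT; first lra.
  by apply/seteqP; split=> x // _; exact: contrapT (bad x).
pose w := V (k + N) x0.
have pw : `|p w - pr P A| < f by rewrite ltNge; apply/negP.
exists (run_ge k N w a); first exact: run_ge_gen.
have mS : measurable (symdiff A (run_ge k N w a)) by exact: measurable_symdiff (mVge k a) (mrun k N w a).
rewrite (prDI P mS mBad).
apply: (@le_trans _ _ (2 * f + f)); last by lra.
apply: lerD; last first.
  by apply: ltW; apply: le_lt_trans Bad_f; apply: pr_le => //; exact: measurableI.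
(* The comparison is made for each state [v] of level [k + N]. If [v] is good, [p v] and [p w] are
   both within [f] of [pr P A], hence within [2 * f] of each other. *)
rewrite -[leRHS]mulr1 -[X in _ <= _ * X](prT P) -[leLHS]mul1r.
apply: (pr_fiber_le (mV (k + N))) => //.
- exact: measurableD.
- by lra.
move=> v; rewrite mul1r setTI.
have mSB : measurable (symdiff A (run_ge k N w a) `\` Bad) by exact: measurableD.
have [pv|pv] := ltP `|p v - pr P A| f; last first.
  rewrite (_ : _ `&` _ = set0) ?pr0; first by rewrite mulr_ge0 ?pr_ge0//; lra.
  apply/seteqP; split=> x // -[[_ nB] Vx]; apply: nB.
  by rewrite /Bad /= Vx.
apply: (@le_trans _ _ (pr P (symdiff (run_ge k N v a) (run_ge k N w a) `&`
   V (k + N) @^-1` [set v]))).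
  apply: pr_le; [exact: measurableI| |].
    by apply: measurableI => //; exact: measurable_symdiff.
  move=> x [[AB _] /= Vx]; split=> //; move: AB.
  by rewrite /symdiff /setD /setU /= /run_ge /= -Vx run_V.
apply: symdiff_run_ge; first by apply: Gfilt_joint; exact: Gfilt_V.
rewrite -/(p v) -/(p w); move: pv pw; rewrite !ltr_norml ler_norml => /andP[? ?] /andP[? ?].
by apply/andP; split; lra.
Qed.

(** The measurable events equal to a table event up to a null set are stable under complements and
    countable unions, so generators suffice. Threshold events give the states, and [J i] is read off
    [V i.+1] and [U i]. *)
Lemma Gfilt_generated k : subset_mod P (Gfilt V J k) (gen_filt U k).
Proof.
pose M (A : set T) := exists B, gen_filt U k B /\ P (symdiff A B) = 0%E.
have M_meas A B : gen_filt U k B -> measurable A -> measurable (symdiff A B).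
  by move=> /mUf mB mA; exact: measurable_symdiff.
suff MG : Gfilt V J k `<=` [set A | measurable A /\ M A] by move=> A /MG[].
have MC A : measurable A -> M A -> M (~` A).
  move=> mA [B [GB e]]; exists (~` B); split; first exact: sigma_genC.
  rewrite -e; congr (P _); apply/seteqP; split=> x;
    rewrite /symdiff /setU /setD /setC /=; have [] := pselect (B x); have [] := pselect (A x); tauto.
have MU (F : nat -> set T) : (forall n, measurable (F n) /\ M (F n)) ->
    M (\bigcup_n F n).
  move=> mF; have /choice[B HB] n : exists B, gen_filt U k B /\ P (symdiff (F n) B) = 0%E.
    by have [_] := mF n.
  exists (\bigcup_n B n); split.
    by apply: sigma_algebra_bigcup => n; have [] := HB n.
  apply: (@subset_measure0 _ _ _ P _ (\bigcup_n symdiff (F n) (B n))).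
  - apply: measurable_symdiff.
      by apply: bigcupT_measurable => n; have [] := mF n.
    by apply: bigcupT_measurable => n; apply: (@mUf k); have [] := HB n.
  - apply: bigcupT_measurable => n; apply: M_meas; first by have [] := HB n.
    by have [] := mF n.
  - move=> x [[[n _ Fx] nB]|[[n _ Bx] nF]].
      by exists n => //; left; split=> // Bx; apply: nB; exists n.
    by exists n => //; right; split=> // Fx; apply: nF; exists n.
  - apply/eqP; rewrite -measure_le0.
    apply: le_trans (measure_sigma_subadditive P _ _ (@subset_refl _ _)) _.
    + by move=> n; apply: M_meas; [have [] := HB n|have [] := mF n].
    + apply: bigcupT_measurable => n; apply: M_meas; first by have [] := HB n.
      by have [] := mF n.
    + by rewrite eseries0// => n _ _; have [] := HB n.
have MI A B : measurable A -> measurable B -> M A -> M B -> M (A `&` B).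
  move=> mA mB MA MB; rewrite -[A `&` B]setCK setCI; apply: (MC).
    by apply: measurableU; exact: measurableC.
  rewrite -bigcup2E; apply: (MU) => -[|[|i]] /=.
  - by split; [exact: measurableC|exact: MC].
  - by split; [exact: measurableC|exact: MC].
  - split=> //; exists set0; split; first exact: (@sigma_algebra0 _ setT).
    by rewrite /symdiff !setD0 setU0 measure0.
have Mgen A : gen_filt U k A -> M A.
  by move=> GA; exists A; rewrite /symdiff !setDv setU0 measure0.
have MVge i a : (k <= i)%N -> M [set x | (a <= V i x)%N].
  move=> ki.
  have [] := @ae_eq_approx _ _ _ P _ [set x | (a <= V i x)%N] (@mUf i) (mVge i a).
    by move=> e e0; exact: V_ge_approx.
  by move=> B [GB e]; exists B; split=> //; exact: gen_filt_le GB.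
have MV i a : (k <= i)%N -> M (V i @^-1` [set a]).
  move=> ki.
  rewrite (_ : _ @^-1` _ = [set x | (a <= V i x)%N] `&` ~` [set x | (a.+1 <= V i x)%N]).
    by apply: MI => //; [exact: measurableC|exact: MVge|apply: MC => //; exact: MVge].
  apply/seteqP; split=> x /=; first by move=> ->; split=> //; lia.
  by move=> [? /negP]; rewrite -leqNgt => ?; apply/eqP; rewrite eqn_leq; apply/andP.
have MJ i a : (k <= i)%N -> M (J i @^-1` [set a]).
  move=> ki; rewrite (_ : _ @^-1` _ = \bigcup_v (V i.+1 @^-1` [set v] `&`
      U i @^-1` [set n | (step i n v)./2 = a])).
    have mUi S : measurable (U i @^-1` S) by exact: measurable_preimage_nat.
    apply: MU => v; split; first exact: measurableI.
    apply: MI => //; first by apply: MV; exact: leqW.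
    by apply: Mgen; exact: gen_filt_U.
  apply/seteqP; split=> x /=; first by rewrite J_step => Jx; exists (V i.+1 x).
  by move=> [v _ [/= <-]]; rewrite J_step.
apply: sigma_genP.
- by split=> //; apply: Mgen; exact: (@sigma_algebra0 _ setT).
- by move=> A [mA MA]; split; [exact: measurableC|exact: MC].
- move=> F mF; split; last exact: MU.
  by apply: bigcupT_measurable => n; have [] := mF n.
- by move=> A [i [a [ki [->|->]]]]; split => //; [exact: MV|exact: MJ].
Qed.

Lemma driver_generating_param : generating_param P V J U.
Proof.
split; [|split; [|split]].
- by move=> k _ B _; rewrite setTI; exact: measurable_preimage_nat.
- by move=> k A B HA _; exact: driver_independent.
- move=> k A /Gfilt_driven GA; exists A; split=> //.
  by rewrite /symdiff setDv setU0 measure0.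
- exact: Gfilt_generated.
Qed.

End driven_process.

(** * Immersion in the filtration of the tables *)

Section immersion.
Context {R : realType} d (T : measurableType d) (P : probability T R)
  (V J U : nat -> T -> nat) (step : nat -> nat -> nat -> nat) (bnd : nat -> nat).
Hypothesis mVJ : proc_measurable V J.
Hypothesis mU : forall k a, measurable (U k @^-1` [set a]).
Hypothesis V_step : forall k x,
  V k x = (V k.+1 x - odd (step k (U k x) (V k.+1 x)))%N.
Hypothesis J_step : forall k x, J k x = (step k (U k x) (V k.+1 x))./2.
Hypothesis indepU : forall k n A, joint_filt V J U k.+1 A ->
  pr P (A `&` U k @^-1` [set n]) = pr P A * pr P (U k @^-1` [set n]).
Hypothesis U_bnd : forall k x, (U k x < bnd k)%N.

(** With the table [U k] frozen at [n], only the past of the path remains to decide [A]; this gives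
    the slice [F n]. *)
Lemma Gfilt_slices k A : Gfilt V J k A -> exists F : nat -> set T,
  (forall n, Gfilt V J k.+1 (F n)) /\ A = [set x | F (U k x) x].
Proof.
move: A; apply: sigma_genP.
- by exists (fun=> set0); split=> // n; exact: (@sigma_algebra0 _ setT).
- move=> A [F [GF ->]]; exists (fun n => ~` F n); split=> // n.
  exact: (sigma_genC (GF n)).
- move=> A /choice[F HF]; exists (fun n => \bigcup_i F i n); split.
    by move=> n; apply: sigma_algebra_bigcup => i; exact: (HF i).1.
  by apply/seteqP; split=> x [i _]; rewrite ?(HF i).2; exists i => //; rewrite (HF i).2.
move=> A [i [a [ki HA]]]; move: ki; rewrite leq_eqVlt => /orP[/eqP ki|ki].
  subst i; case: HA => ->.
    exists (fun n => V k.+1 @^-1` [set v | (v - odd (step k n v))%N = a]); split.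
      by move=> n; apply: sigma_gen_preimage => v; exact: Gfilt_V.
    by apply/seteqP; split=> x; rewrite /preimage /= (V_step k).
  exists (fun n => V k.+1 @^-1` [set v | (step k n v)./2 = a]); split.
    by move=> n; apply: sigma_gen_preimage => v; exact: Gfilt_V.
  by apply/seteqP; split=> x; rewrite /preimage /= (J_step k).
exists (fun=> A); split=> // n.
by case: HA => ->; [exact: Gfilt_V|exact: Gfilt_J].
Qed.

Lemma driver_immersed : (forall k, subset_mod P (Gfilt V J k) (gen_filt U k)) ->
  immersed P (Gfilt V J) (gen_filt U).
Proof.
move=> GU; split=> // k A GA.
have mA : measurable A by exact: Gfilt_measurable GA.
have [F [GF AF]] := Gfilt_slices GA.
have mF n : measurable (F n) by exact: Gfilt_measurable (GF n).
pose u n := pr P (U k @^-1` [set n]).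
(* The table is integrated out: [U k] is independent of the joint past, so averaging the slices
   against its law gives the conditional probability of [A], which depends on the path alone. *)
pose Y x : R := \sum_(n < bnd k) u n * \1_(F n) x.
have u1 : \sum_(n < bnd k) u n = 1.
  rewrite -(prT P) (@pr_fiber_sum _ _ _ P (U k) (bnd k))//.
  by apply: eq_bigr => n _; rewrite setTI.
exists Y; split; [|split].
- move=> x; apply/andP; split.
    by apply: sumr_ge0 => n _; rewrite mulr_ge0// pr_ge0.
  rewrite -u1; apply: ler_sum => n _; rewrite ler_piMr ?pr_ge0// indicE.
- move=> b.
  (* Measurability is required for [Gfilt V J k.+1], hence the space is retyped with that
     sigma-algebra. *)
  pose G := proc_gen V J k.+1; pose T' := g_sigma_algebraType G.
  have mY : measurable_fun setT (Y : T' -> R).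
    apply: measurable_sum => n; apply: measurable_funM; first exact: measurable_cst.
    by apply: measurable_indic; exact: GF.
  have := mY measurableT `]-oo, b]%classic (measurable_itv _).
  by rewrite setTI; congr (Gfilt V J k.+1 _); apply/seteqP; split=> x; rewrite /preimage /= in_itv.
move=> B UB.
have mB : measurable B by exact: gen_filt_measurable UB.
have mAB : measurable (A `&` B) by exact: measurableI.
have term n : pr P (A `&` B `&` U k @^-1` [set n]) = u n * pr P (F n `&` B).
  rewrite [RHS]mulrC -indepU.
    congr (pr P _); rewrite AF; apply/seteqP; split=> x /=.
      by move=> [[Fx Bx] Ux]; rewrite -Ux.
    by move=> [[Fx Bx] Ux]; rewrite Ux.
  apply: sigma_genI; first by apply: Gfilt_joint; exact: GF.
  exact: gen_filt_joint UB.
rewrite prE// (@pr_fiber_sum _ _ _ P (U k) (bnd k))//.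
under eq_integral do rewrite /Y -sumEFin.
rewrite ge0_integral_sum//.
- rewrite -sumEFin; apply: eq_bigr => n _; rewrite term.
  under eq_integral do rewrite EFinM.
  rewrite integralZl//; last first.
    by apply: (@integrableS _ _ _ _ setT) => //; exact: integrable_indic.
  rewrite integral_indic// EFinM; congr (_ * _)%E.
  exact/esym/(prE P (measurableI _ _ (mF n) mB)).
- move=> n; apply/measurable_EFinP; apply: measurable_funM => //.
- by move=> n x _; rewrite lee_fin mulr_ge0// pr_ge0.
Qed.

End immersion.

(** * Independent sequences by nested intervals *)

Section nested_intervals.
Context {R : realType}.
Variables (q : nat -> nat -> R) (b : nat -> nat).
Hypothesis q_ge0 : forall k n, 0 <= q k n.
Hypothesis q_sum1 : forall k, \sum_(n < b k) q k n = 1.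

Let cumul k n := \sum_(m < n) q k m.

Let cumulS k n : cumul k n.+1 = cumul k n + q k n.
Proof. exact: big_ord_recr. Qed.

Let cumul_le k m n : (m <= n)%N -> cumul k m <= cumul k n.
Proof.
move=> /subnK <-; elim: (n - m)%N => [|i IH] //.
by rewrite addSn cumulS (le_trans IH)// lerDl.
Qed.

Let cumul_ge0 k n : 0 <= cumul k n.
Proof. by apply: sumr_ge0. Qed.

(* Words are stored with their most recent letter first. *)
Fixpoint word_prob (s : seq nat) : R :=
  if s is n :: s' then word_prob s' * q (size s') n else 1.

(** Left end of the interval attached to a word: the interval of [s] is cut from left to right into
    pieces proportional to the weights [q (size s)]. *)
Fixpoint word_start (s : seq nat) : R :=
  if s is n :: s' then word_start s' + word_prob s' * cumul (size s') n else 0.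

Definition in_word s x := word_start s <= x < word_start s + word_prob s.

(** Inside the interval of [s] exactly one letter qualifies; the default [0] is returned only
    outside it. *)
Definition next_letter s x := head 0%N [seq n <- iota 0 (b (size s)) | in_word (n :: s) x].

Fixpoint letters k x : seq nat :=
  if k is k'.+1 then next_letter (letters k' x) x :: letters k' x else [::].

Definition letter k x := next_letter (letters k x) x.

Fixpoint valid_word (s : seq nat) :=
  if s is n :: s' then (n < b (size s'))%N && valid_word s' else true.

Let word_prob_ge0 s : 0 <= word_prob s.
Proof. by elim: s => //= n s IH; rewrite mulr_ge0. Qed.

Let in_word_cons n s x : in_word (n :: s) x =
  (word_start s + word_prob s * cumul (size s) n <= x <
   word_start s + word_prob s * cumul (size s) n.+1).
Proof. by rewrite /in_word /= cumulS mulrDr addrA. Qed.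

Let cumul1 k n : (n <= b k)%N -> cumul k n <= 1.
Proof. by move=> nb; rewrite -(q_sum1 k); exact: cumul_le. Qed.

Let in_word_behead n s x : (n < b (size s))%N -> in_word (n :: s) x -> in_word s x.
Proof.
move=> nb; rewrite in_word_cons /in_word => /andP[le lt]; apply/andP; split.
  by apply: le_trans le; rewrite lerDl mulr_ge0.
by apply: lt_le_trans lt _; rewrite lerD2l ler_piMr// cumul1.
Qed.

Let in_word_inj m n s x : in_word (m :: s) x -> in_word (n :: s) x -> m = n.
Proof.
rewrite !in_word_cons => /andP[m1 m2] /andP[n1 n2].
have ord i j : (i < j)%N -> word_start s + word_prob s * cumul (size s) i.+1 <=
    word_start s + word_prob s * cumul (size s) j.
  by move=> ij; rewrite lerD2l ler_wpM2l// cumul_le.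
case: (ltngtP m n) => // /ord H.
  by have := lt_le_trans m2 (le_trans H n1); rewrite ltxx.
by have := lt_le_trans n2 (le_trans H m1); rewrite ltxx.
Qed.

Let next_letterP s x : in_word s x ->
  (next_letter s x < b (size s))%N /\ in_word (next_letter s x :: s) x.
Proof.
move=> /andP[le lt].
have [n nb xn] : exists2 n, (n < b (size s))%N & in_word (n :: s) x.
  have : x < word_start s + word_prob s * cumul (size s) (b (size s)).
    by rewrite /cumul q_sum1 mulr1.
  elim: (b (size s)) => [|m IH].
    by rewrite /cumul big_ord0 mulr0 addr0 ltNge le.
  have [lt' _|ge lt'] := ltP x (word_start s + word_prob s * cumul (size s) m).
    by have [n nm xn] := IH lt'; exists n => //; exact: ltnW.
  by exists m => //; rewrite in_word_cons ge.
have : n \in [seq n <- iota 0 (b (size s)) | in_word (n :: s) x].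
  by rewrite mem_filter mem_iota xn.
rewrite /next_letter; case E: [seq _ <- _ | _] => [|m l] //= _.
have : m \in [seq n <- iota 0 (b (size s)) | in_word (n :: s) x].
  by rewrite E inE eqxx.
by rewrite mem_filter mem_iota /= add0n => /andP[].
Qed.

Let in_word_letters s x : valid_word s -> in_word s x -> letters (size s) x = s.
Proof.
elim: s => //= n s IH /andP[nb vs] xn.
have xs := in_word_behead nb xn; rewrite IH//; congr (_ :: _).
by apply: in_word_inj xn; have [] := next_letterP xs.
Qed.

Lemma measurable_in_word s : measurable [set x | in_word s x].
Proof.
rewrite (_ : mkset _ = `[word_start s, word_start s + word_prob s[%classic); last first.
  by apply/seteqP; split=> x; rewrite /= in_itv.
exact: measurable_itv.
Qed.

Lemma measurable_letters k s : measurable [set x | letters k x = s].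
Proof.
elim: k s => [|k IH] s.
  case: s => [|n s] /=; first by rewrite (_ : mkset _ = setT)//; apply/seteqP; split.
  by rewrite (_ : mkset _ = set0)//; apply/seteqP; split.
case: s => [|n s] /=; first by rewrite (_ : mkset _ = set0)//; apply/seteqP; split.
(* Stated for an arbitrary list of candidates, so that the search for the first suitable letter is
   handled by induction on the list. *)
have mnext (l : seq nat) :
    measurable [set x | head 0%N [seq m <- l | in_word (m :: s) x] = n].
  elim: l => [|m l IHl] /=.
    have [->|n0] := eqVneq n 0%N; first by rewrite (_ : mkset _ = setT)//; apply/seteqP; split.
    by rewrite (_ : mkset _ = set0)//; apply/seteqP; split=> // x /= /esym/eqP; rewrite (negbTE n0).
  rewrite (_ : mkset _ = ([set x | in_word (m :: s) x] `&` [set _ | m = n]) `|`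
    (~` [set x | in_word (m :: s) x] `&`
     [set x | head 0%N [seq m <- l | in_word (m :: s) x] = n])); last first.
    apply/seteqP; split=> x; rewrite /setU /setI /setC /=; case: ifP => xm /=.
    - by left.
    - by right.
    - by case=> [[]//|[]].
    - by case=> [[]//|[]].
  apply: measurableU; apply: measurableI => //.
  - exact: measurable_in_word.
  - have [->|mn] := eqVneq m n; first by rewrite (_ : mkset _ = setT)//; apply/seteqP; split.
    by rewrite (_ : mkset _ = set0)//; apply/seteqP; split=> // x /= /eqP; rewrite (negbTE mn).
  - by apply: measurableC; exact: measurable_in_word.
rewrite (_ : mkset _ = [set x | letters k x = s] `&`
  [set x | head 0%N [seq m <- iota 0 (b (size s)) | in_word (m :: s) x] = n]).
  exact: measurableI.
apply/seteqP; split=> x /=; first by move=> [<- <-].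
by move=> [-> <-].
Qed.

Lemma measurable_letter k n : measurable (letter k @^-1` [set n]).
Proof.
(* The letters preceding the [k]th one form a word, and words are countably many; [unpickle]
   enumerates them. *)
rewrite (_ : _ @^-1` _ =
    \bigcup_i [set x | letters k.+1 x = n :: odflt [::] (unpickle i)]).
  by apply: bigcupT_measurable => i; exact: measurable_letters.
apply/seteqP; split=> [x <-|x [i _ [<-]]] //.
by exists (pickle (letters k x)); [by []|rewrite /mkset pickleK].
Qed.

Let Lam : probability _ R := uniform_prob (@ltr01 R).

Lemma uniform01_itv (x y : R) : 0 <= x -> x <= y -> y <= 1 ->
  pr Lam `[x, y[%classic = y - x.
Proof.
move=> x0 xy y1; rewrite /pr /Lam /= /uniform_prob.
rewrite (eq_integral (fun=> 1%:E)); last first.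
  move=> z; rewrite inE /= in_itv /= => /andP[xz zy].
  by rewrite /uniform_pdf (le_trans x0 xz) (ltW (lt_le_trans zy y1)) subr0 invr1.
rewrite integral_cst//= mul1e lebesgue_measure_itv /= lte_fin.
case: ltP => [_|yx]; first by rewrite -EFinB.
have -> : y = x by lra.
by rewrite subrr.
Qed.

Let word_bounds s : valid_word s ->
  0 <= word_start s /\ word_start s + word_prob s <= 1.
Proof.
elim: s => [_|n s IH /= /andP[nb /IH[s0 s1]]]; first by rewrite /= add0r.
split; first by rewrite addr_ge0// mulr_ge0.
apply: le_trans s1; rewrite -addrA lerD2l -mulrDr -cumulS.
by rewrite ler_piMr// cumul1.
Qed.

Let pr_word s : valid_word s -> pr Lam [set x | in_word s x] = word_prob s.
Proof.
move=> /word_bounds[s0 s1].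
rewrite (_ : mkset _ = `[word_start s, word_start s + word_prob s[%classic); last first.
  by apply/seteqP; split=> x; rewrite /= in_itv.
by rewrite uniform01_itv// ?lerDl// addrC addKr.
Qed.

Let constrained l u (S : nat -> pred nat) :=
  [set x | forall k, (l <= k < u)%N -> S k (letter k x)].

Let measurable_constrained l u S : measurable (constrained l u S).
Proof.
rewrite (_ : constrained _ _ _ =
   \bigcap_(k in [set k | (l <= k < u)%N]) (letter k @^-1` [set n | S k n])).
  apply: bigcap_measurableType => k _; apply: measurable_preimage_nat => n.
  exact: measurable_letter.
by apply/seteqP; split=> x Hx k /= /Hx.
Qed.

(** An arbitrary initial word [s] is allowed so that the induction can lengthen it: splitting on the
    next letter [n] multiplies the mass by [q (size s) n]. *)
Let pr_word_constrained r s S : valid_word s ->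
  pr Lam ([set x | in_word s x] `&` constrained (size s) (size s + r) S) =
  word_prob s * \prod_(size s <= k < size s + r) \sum_(n < b k | S k n) q k n.
Proof.
elim: r s => [|r IH] s vs.
  rewrite addn0 big_geq// mulr1 -(pr_word vs); congr (pr Lam _).
  by apply/seteqP; split=> [x []//|x xs]; split=> // k; lia.
have mW : measurable ([set x | in_word s x] `&` constrained (size s) (size s + r.+1) S).
  by apply: measurableI; [exact: measurable_in_word|exact: measurable_constrained].
rewrite (@pr_fiber_sum _ _ _ Lam (letter (size s)) (b (size s))) //; last 2 first.
- by move=> n; exact: measurable_letter.
- by move=> x [xs _]; rewrite /letter in_word_letters//; have [] := next_letterP xs.
rewrite big_ltn; last by lia.
rewrite mulr_suml mulr_sumr [RHS]big_mkcond /=; apply: eq_bigr => n _.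
case: ifPn => [Sn|nSn]; last first.
  rewrite (_ : _ `&` _ = set0) ?pr0//; apply/seteqP; split=> x // -[[_ Sx] /= nx].
  by move: (Sx (size s)); rewrite nx (negbTE nSn) => /(_ _)/implyP; lia.
have := IH (nat_of_ord n :: s); rewrite /= ltn_ord vs addSnnS mulrA => /(_ isT) <-.
congr (pr Lam _); apply/seteqP; split=> x.
  move=> [[/= xs Sx] nx]; split=> /=.
    have [_] := next_letterP xs; move: nx.
    by rewrite /letter in_word_letters// => ->.
  by move=> k kr; apply: Sx; lia.
move=> [/= xn Sx]; have xs := in_word_behead (ltn_ord n) xn.
have nx : letter (size s) x = n.
  rewrite /letter in_word_letters//.
  by apply: in_word_inj xn; have [] := next_letterP xs.
split=> //; split=> // k; rewrite leq_eqVlt => /andP[/orP[/eqP <- _|lk kr]].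
  by rewrite nx.
by apply: Sx; rewrite lk.
Qed.

(** A single uniform point of the unit interval suffices: its successive letters in the nested
    subdivision are independent with the prescribed laws. *)
Lemma exists_independent_sequence :
  exists d (Omega : measurableType d) (L : probability Omega R)
         (xi : nat -> Omega -> nat),
    (forall k n, measurable (xi k @^-1` [set n])) /\
    forall N (S : nat -> pred nat),
      pr L [set x | forall k, (k < N)%N -> S k (xi k x)] =
      \prod_(k < N) \sum_(n < b k | S k n) q k n.
Proof.
exists _, _, Lam, letter; split; first exact: measurable_letter.
move=> N S; have := @pr_word_constrained N [::] S isT.
rewrite /= mul1r add0n big_mkord => <-.
have mC := measurable_constrained 0 N S.
have mW := measurable_in_word [::].
have -> : [set x | forall k, (k < N)%N -> S k (letter k x)] = constrained 0 N S.
  by [].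
(* [Lam] lives on the whole line; the points outside the interval of the empty word, whose letters
   are defaults, form a null set. *)
suff out0 : pr Lam (constrained 0 N S `\` [set x | in_word [::] x]) = 0.
  by rewrite (prDI Lam mC mW) out0 add0r setIC.
apply/eqP; rewrite eq_le pr_ge0 andbT.
apply: (@le_trans _ _ (pr Lam (~` [set x | in_word [::] x]))).
  apply: pr_le; [exact: measurableD|exact: measurableC|by move=> x []].
by rewrite prC// pr_word// subrr.
Qed.

End nested_intervals.

(** * The parameterization *)

Section edges.
Context {R : realType} d (T : measurableType d) (P : probability T R)
  (V J : nat -> T -> nat).
Hypothesis eVJ : euler_process V J.
Hypothesis mVJ : proc_measurable V J.
Hypothesis condVJ : cond_law_hyp P V J.

(** The lowest bit records whether the state drops, which it does by at most one, and the remaining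
    bits hold [J k]; the edge is recovered from this code and the state it leaves. *)
Definition edge k x := ((J k x).*2 + (V k.+1 x - V k x))%N.

Lemma V_le k x : (V k x <= k)%N.
Proof. by have [] := eVJ x k. Qed.

Lemma V_edge k x : V k x = (V k.+1 x - odd (edge k x))%N.
Proof. by have [_] := eVJ x k; rewrite /edge => -[[-> _]|[-> _]]; lia. Qed.

Lemma J_edge k x : J k x = (edge k x)./2.
Proof. by have [_] := eVJ x k; rewrite /edge => -[[-> _]|[-> _]]; lia. Qed.

Lemma edge_lt k x : (edge k x < k.*2.+2)%N.
Proof. by have [] := eVJ x k; rewrite /edge => ? [[-> ?]|[-> ?]]; lia. Qed.

Let mV k a : measurable (V k @^-1` [set a]).
Proof. by case: mVJ. Qed.

Lemma measurable_edge k e : measurable (edge k @^-1` [set e]).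
Proof.
apply: (@Gfilt_measurable _ _ V J k) => //.
pose E v := [set x | (fun j => [set x | ((j.*2 + (V k.+1 x - v))%N = e)]) (J k x) x].
apply: (@sigma_gen_fiber _ _ (V k) E) => v; first exact: Gfilt_V.
apply: (@sigma_gen_fiber _ _ (J k)
   (fun j => [set x | ((j.*2 + (V k.+1 x - v))%N = e)])) => j; first exact: Gfilt_J.
apply: (@sigma_gen_preimage _ _ (V k.+1) [set w | ((j.*2 + (w - v))%N = e)]) => w.
exact: Gfilt_V.
Qed.

(** At a state of probability zero the conditional law is replaced by the point mass at code [0], so
    that a probability is available for every entry of a table. *)
Definition edge_law k w e : R :=
  if pr P (V k.+1 @^-1` [set w]) == 0 then (e == 0%N)%:R
  else pr P (V k.+1 @^-1` [set w] `&` edge k @^-1` [set e]) /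
       pr P (V k.+1 @^-1` [set w]).

Lemma edge_law_ge0 k w e : 0 <= edge_law k w e.
Proof. by rewrite /edge_law; case: ifP => // _; rewrite divr_ge0 ?pr_ge0. Qed.

Lemma edge_law_sum1 k w : \sum_(e < k.*2.+2) edge_law k w e = 1.
Proof.
rewrite /edge_law; case: (eqVneq (pr P (V k.+1 @^-1` [set w])) 0) => [_|n0].
  by rewrite big_ord_recl /= big1 ?addr0// => i _.
rewrite -mulr_suml -(@pr_fiber_sum R d T P (edge k) k.*2.+2 (V k.+1 @^-1` [set w])) ?divff//.
- by move=> e; exact: measurable_edge.
- by move=> x _; exact: edge_lt.
Qed.

(** This is [cond_law_hyp] in terms of codes: once the state [w] is known, the code [e] amounts to
    the pair of values of [V k] and [J k]. *)
Lemma edge_law_cond k A w e : Gfilt V J k.+1 A ->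
  pr P (A `&` V k.+1 @^-1` [set w] `&` edge k @^-1` [set e]) =
  pr P (A `&` V k.+1 @^-1` [set w]) * edge_law k w e.
Proof.
move=> GA; have mA : measurable A by exact: Gfilt_measurable GA.
have mE := measurable_edge k e; have mVw := mV k.+1 w.
have mAV : measurable (A `&` V k.+1 @^-1` [set w]) by exact: measurableI.
rewrite /edge_law; case: ifPn => [/eqP V0|n0].
  have AV0 : pr P (A `&` V k.+1 @^-1` [set w]) = 0.
    by apply/eqP; rewrite eq_le pr_ge0 -V0 andbT; apply: pr_le => // x [].
  rewrite AV0 mul0r; apply/eqP; rewrite eq_le pr_ge0 -AV0 andbT.
  by apply: pr_le => [||x []] //; exact: measurableI.
(* An odd code is a drop by one, impossible from state [0]. This case is removed first because
   [w - odd e] would be truncated there. *)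
have [we|we] := leqP (odd e) w; last first.
  have no : V k.+1 @^-1` [set w] `&` edge k @^-1` [set e] = set0.
    apply/seteqP; split=> x // -[/= Vx ex].
    have := V_edge k x; have [_] := eVJ x k; rewrite /edge in ex *.
    by rewrite -Vx -ex in we; lia.
  by rewrite -setIA no setI0 pr0 mul0r mulr0.
have := condVJ w (w - odd e)%N e./2 GA; rewrite /=.
have Ee : V k.+1 @^-1` [set w] `&`
    (V k @^-1` [set (w - odd e)%N] `&` J k @^-1` [set e./2]) =
    V k.+1 @^-1` [set w] `&` edge k @^-1` [set e].
  apply/seteqP; split=> x [/= Vx].
    by move=> [/= Vk Jk]; split=> //=; rewrite /edge Vx Vk Jk; lia.
  by move=> /= ex; split=> //; split=> /=; rewrite 1?(V_edge k) 1?(J_edge k) ex ?Vx.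
rewrite -!setIA Ee !setIA.
rewrite !prE//; do ?exact: measurableI.
rewrite -!EFinM => -[] eq.
by apply: (mulIf n0); rewrite eq mulrA divfK.
Qed.

End edges.

(** * Random tables of edges on an enlarged space *)

Section driver.
Context {R : realType} d (T : measurableType d) (P : probability T R)
  (V J : nat -> T -> nat).
Hypothesis eVJ : euler_process V J.
Hypothesis mVJ : proc_measurable V J.
Hypothesis condVJ : cond_law_hyp P V J.

(** One edge code for each of the [k + 2] states of level [k.+1]. The type varies with [k];
    numbering the finitely many tables by [code] lets all drivers take values in [nat]. *)
Definition jump_table k := {ffun 'I_k.+2 -> 'I_k.*2.+2}.

Definition decode k n : jump_table k := nth [ffun=> ord0] (enum {: jump_table k}) n.
Definition code k (f : jump_table k) : nat := index f (enum {: jump_table k}).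

Lemma codeK k : cancel (@code k) (@decode k).
Proof. by move=> f; rewrite /decode nth_index// mem_enum. Qed.

Lemma code_lt k f : (@code k f < #|{: jump_table k}|)%N.
Proof. by rewrite /code cardE index_mem mem_enum. Qed.

Lemma decodeK k n : (n < #|{: jump_table k}|)%N -> code (@decode k n) = n.
Proof. by move=> nb; rewrite /code /decode index_uniq ?enum_uniq -?cardE. Qed.

Definition table_law k n : R :=
  \prod_(w < k.+2) edge_law P V J k w (@decode k n w).

(** Distributivity of products over sums; it expresses that the entries of a table are independent
    under [table_law]. *)
Lemma table_law_prod k (Q : 'I_k.+2 -> pred 'I_k.*2.+2) :
  \sum_(n < #|{: jump_table k}| | [forall w, Q w (@decode k n w)]) table_law k n =
  \prod_(w < k.+2) \sum_(e | Q w e) edge_law P V J k w e.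
Proof.
rewrite bigA_distr_big_dep /=.
pose G (f : jump_table k) := \prod_(w < k.+2) edge_law P V J k w (f w).
transitivity (\sum_(f : jump_table k | [forall w, Q w (f w)]) G f); last first.
  by apply: eq_bigl => f; apply/forallP/familyP => H w; exact: H.
transitivity (\sum_(f <- enum {: jump_table k} | [forall w, Q w (f w)]) G f).
  by rewrite (big_nth [ffun=> ord0]) -cardE big_mkord; exact: eq_bigl.
by rewrite big_enum_cond; exact: eq_bigl.
Qed.

Lemma table_law_ge0 k n : 0 <= table_law k n.
Proof. by apply: prodr_ge0 => w _; exact: edge_law_ge0. Qed.

Lemma table_law_sum1 k : \sum_(n < #|{: jump_table k}|) table_law k n = 1.
Proof.
have := table_law_prod (fun (_ : 'I_k.+2) (_ : 'I_k.*2.+2) => true).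
rewrite [X in _ = X]big1 => [H|w _]; last exact: edge_law_sum1.
by rewrite -[RHS]H; apply: eq_bigl => n; apply/esym/forallP.
Qed.

Section extension.
Context d2 (Omega : measurableType d2) (L : probability Omega R)
  (xi : nat -> Omega -> nat).
Hypothesis mxi : forall k n, measurable (xi k @^-1` [set n]).
Hypothesis law_xi : forall N (S : nat -> pred nat),
  pr L [set x | forall k, (k < N)%N -> S k (xi k x)] =
  \prod_(k < N) \sum_(n < #|{: jump_table k}| | S k n) table_law k n.

Let P2 : probability (T * Omega)%type R := (P \x L)%E.
Let V2 k (z : T * Omega) := V k z.1.
Let J2 k (z : T * Omega) := J k z.1.

(* Only the entry of the table at V_(k+1) comes from the path; the others are
   redrawn independently. *)
Definition tables k x y : jump_table k :=
  [ffun w : 'I_k.+2 => if w == V k.+1 x :> nat then inord (edge V J k x)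
                       else @decode k (xi k y) w].
Definition driver k (z : T * Omega) := code (tables k z.1 z.2).
(** This is the [step] function of the driven process. *)
Definition read_table k n w : nat := @decode k n (inord w).

Let read_driver k z : read_table k (driver k z) (V2 k.+1 z) = edge V J k z.1.
Proof.
rewrite /read_table /driver codeK ffunE inordK ?eqxx.
  by rewrite inordK//; exact: (edge_lt eVJ).
by rewrite ltnS; exact: (V_le eVJ).
Qed.

Lemma V_driver k z :
  V2 k z = (V2 k.+1 z - odd (read_table k (driver k z) (V2 k.+1 z)))%N.
Proof. by rewrite read_driver /V2 (V_edge eVJ). Qed.

Lemma J_driver k z : J2 k z = (read_table k (driver k z) (V2 k.+1 z))./2.
Proof. by rewrite read_driver /J2 (J_edge eVJ). Qed.

Lemma driver_lt k z : (driver k z < #|{: jump_table k}|)%N.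
Proof. exact: code_lt. Qed.

Let cyl l u (S : nat -> pred nat) :=
  [set y | forall k, (l <= k < u)%N -> S k (xi k y)].

Let mcyl l u S : measurable (cyl l u S).
Proof.
rewrite (_ : cyl _ _ _ =
   \bigcap_(k in [set k | (l <= k < u)%N]) (xi k @^-1` [set n | S k n])).
  by apply: bigcap_measurableType => k _; exact: measurable_preimage_nat.
by apply/seteqP; split=> x Hx k /= /Hx.
Qed.

(** Both events are written as constraints on the first [N] coordinates, with [true] where nothing
    is imposed; the two products then differ only in the factor of index [k]. *)
Lemma cyl_independent k u S (Q : pred nat) :
  pr L (cyl k.+1 u S `&` xi k @^-1` [set n | Q n]) =
  pr L (cyl k.+1 u S) * \sum_(n < #|{: jump_table k}| | Q n) table_law k n.
Proof.
pose N := maxn u k.+1.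
pose S0 i n := if (k < i < u)%N then S i n else true.
pose S1 i n := if i == k then Q n else S0 i n.
have -> : cyl k.+1 u S = [set y | forall i, (i < N)%N -> S0 i (xi i y)].
  apply/seteqP; split=> y Sy i /=.
    by rewrite /S0; case: ifP => // ki _; exact: Sy.
  by move=> ki; have := Sy i; rewrite /S0 ki; apply; rewrite /N; lia.
have -> : [set y | forall i, (i < N)%N -> S0 i (xi i y)] `&`
    xi k @^-1` [set n | Q n] = [set y | forall i, (i < N)%N -> S1 i (xi i y)].
  apply/seteqP; split=> [y [Sy Qy] i iN|y Sy].
    by rewrite /S1; case: eqP => [->|_] //; exact: Sy.
  split=> [i iN|/=].
    have [->|ik] := eqVneq i k; first by rewrite /S0 /= ltnn.
    by have := Sy i iN; rewrite /S1 ifN.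
  by have := Sy k; rewrite /S1 eqxx; apply; rewrite /N; lia.
rewrite !law_xi; have kN : (k < N)%N by rewrite /N; lia.
rewrite (bigD1 (Ordinal kN)) //= [in RHS](bigD1 (Ordinal kN)) //=.
have -> : \sum_(n < #|{: jump_table k}| | S1 k n) table_law k n =
    \sum_(n < #|{: jump_table k}| | Q n) table_law k n.
  by apply: eq_bigl => n; rewrite /S1 eqxx.
have -> : \sum_(n < #|{: jump_table k}| | S0 k n) table_law k n = 1.
  by rewrite -[RHS](table_law_sum1 k); apply: eq_bigl => n; rewrite /S0 ltnn.
rewrite mul1r mulrC; congr (_ * _); apply: eq_bigr => i ik.
apply: eq_bigl => n; rewrite /S1 ifN//.
Qed.

(** Past events of the path times finite cylinders of the auxiliary tables: a family stable under
    intersection, whose sigma-algebra contains the joint past at level [k]. *)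
Let rect k := [set C | exists A u S, Gfilt V J k A /\
  C = [set z : T * Omega | A z.1 /\ cyl k u S z.2]].

Let pr_rect A B : measurable A -> measurable B ->
  pr P2 [set z | A z.1 /\ B z.2] = pr P A * pr L B.
Proof.
move=> mA mB; apply: EFin_inj; rewrite EFinM -!prE//; last first.
  exact: measurableX.
exact: product_measure1E.
Qed.

Let mrect A B : measurable A -> measurable B ->
  measurable [set z : T * Omega | A z.1 /\ B z.2].
Proof. by move=> mA mB; exact: measurableX. Qed.

Let mfst A : measurable A -> measurable [set z : T * Omega | A z.1].
Proof.
move=> mA; rewrite (_ : mkset _ = [set z | A z.1 /\ setT z.2]); first exact: mrect.
by apply/seteqP; split=> z; [|case].
Qed.

Let mV2 k a : measurable (V2 k @^-1` [set a]).
Proof. by apply: (@mfst (V k @^-1` [set a])); case: mVJ. Qed.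

Lemma proc_measurable_ext : proc_measurable V2 J2.
Proof.
split=> // k a; apply: (@mfst (J k @^-1` [set a])); by case: mVJ.
Qed.

Let rect_measurable k : rect k `<=` measurable.
Proof.
move=> C [A [u [S [GA ->]]]]; apply: mrect => //.
exact: Gfilt_measurable GA.
Qed.

Let rect_fst k A : Gfilt V J k A -> rect k [set z | A z.1].
Proof.
move=> GA; exists A, 0%N, (fun _ _ => true); split=> //.
by apply/seteqP; split=> [z Az|z []] //; split=> // i; lia.
Qed.

Let rect_xi k i n : (k <= i)%N -> rect k [set z | xi i z.2 = n].
Proof.
move=> ki; exists setT, i.+1, (fun j m => (j == i) ==> (m == n)); split.
  exact: sigma_genT.
apply/seteqP; split=> z /=.
  by move=> <-; split=> // j _; apply/implyP => /eqP->.
move=> [_ /(_ i)]; rewrite ki ltnSn eqxx /= => /(_ isT) /eqP; exact.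
Qed.

Let rect_gen_V k i a : (k <= i)%N -> <<s rect k >> (V2 i @^-1` [set a]).
Proof. by move=> ki; apply: sub_sigma_algebra; exact: (rect_fst (@Gfilt_V _ V J k i a ki)). Qed.

Let rect_gen_J k i a : (k <= i)%N -> <<s rect k >> (J2 i @^-1` [set a]).
Proof. by move=> ki; apply: sub_sigma_algebra; exact: (rect_fst (@Gfilt_J _ V J k i a ki)). Qed.

(** The table depends on four discrete variables, [V i.+1], [V i], [J i] and [xi i], which are
    frozen one after the other. *)
Let rect_gen_driver k i B : (k <= i)%N -> <<s rect k >> (driver i @^-1` B).
Proof.
move=> ki.
pose table v' v j n : jump_table i :=
  [ffun w : 'I_i.+2 => if w == v' :> nat then inord (j.*2 + (v' - v))%N
                       else @decode i n w].
pose E3 (v' v j : nat) := [set z : T * Omega | B (code (table v' v j (xi i z.2)))].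
pose E2 (v' v : nat) := [set z : T * Omega | E3 v' v (J2 i z) z].
pose E1 (v' : nat) := [set z : T * Omega | E2 v' (V2 i z) z].
apply: (@sigma_gen_fiber _ _ (V2 i.+1) E1) => v'; first exact: rect_gen_V (leqW ki).
apply: (@sigma_gen_fiber _ _ (V2 i) (E2 v')) => v; first exact: rect_gen_V.
apply: (@sigma_gen_fiber _ _ (J2 i) (E3 v' v)) => j; first exact: rect_gen_J.
apply: (@sigma_gen_preimage _ _ (fun z => xi i z.2)
   [set n | B (code (table v' v j n))]) => n.
by apply: sub_sigma_algebra; exact: rect_xi.
Qed.

Lemma measurable_driver k n : measurable (driver k @^-1` [set n]).
Proof. exact: (sigma_gen_measurable (@rect_measurable k) (rect_gen_driver _ (leqnn k))). Qed.

Let joint_rect k : joint_filt V2 J2 driver k `<=` <<s rect k >>.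
Proof.
have sC (A : set (T * Omega)) : <<s rect k >> A -> <<s rect k >> (~` A).
  exact: sigma_genC.
have sU (F : nat -> set (T * Omega)) : (forall n, <<s rect k >> (F n)) ->
    <<s rect k >> (\bigcup_n F n) by exact: sigma_algebra_bigcup.
have s0 : <<s rect k >> set0 by exact: (@sigma_algebra0 _ setT).
apply: sigma_genP => // A [|].
  move: A; apply: sigma_genP => // A [i [a [ki [->|->]]]].
    exact: rect_gen_V.
  exact: rect_gen_J.
move: A; apply: sigma_genP => // A [i [B [ki [_ ->]]]].
exact: rect_gen_driver.
Qed.

(** When [V k.+1] is [w], the table has number [n] if and only if the path uses its entry at [w] and
    [xi k] agrees with it at all other states. The path contributes the factor [edge_law] at [w] and
    [xi k] the others, so the product does not depend on [w]. *)
Let driver_rect k n C : rect k.+1 C -> (n < #|{: jump_table k}|)%N ->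
  pr P2 (C `&` driver k @^-1` [set n]) = table_law k n * pr P2 C.
Proof.
move=> rC nb; have mC := rect_measurable rC.
have mU := measurable_driver k n.
case: rC => A [u [S [GA EC]]]; have mA : measurable A by exact: Gfilt_measurable GA.
rewrite -[LHS]mul1r; apply: (pr_fiber (mV2 k.+1)) => //.
- exact: measurableI.
- exact: table_law_ge0.
move=> w; rewrite mul1r.
have [wk|kw] := ltnP w k.+2; last first.
  have -> : V2 k.+1 @^-1` [set w] = set0.
    apply/seteqP; split=> z // /= Vz; have := V_le eVJ k.+1 z.1.
    by rewrite /V2 in Vz; rewrite Vz; lia.
  by rewrite !setI0 pr0 mulr0.
pose w0 := Ordinal wk; pose f := @decode k n.
pose Q m := [forall w' : 'I_k.+2, (w' != w0) ==> (@decode k m w' == f w')].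
pose AV := A `&` V k.+1 @^-1` [set w].
have mAV : measurable AV by apply: measurableI => //; case: mVJ.
have mE := measurable_edge mVJ k (f w0).
have -> : C `&` driver k @^-1` [set n] `&` V2 k.+1 @^-1` [set w] =
    [set z | (AV `&` edge V J k @^-1` [set f w0 : nat]) z.1 /\
             (cyl k.+1 u S `&` xi k @^-1` [set m | Q m]) z.2].
  rewrite EC; apply/seteqP; split=> z.
    move=> [[[Az Sz] /= Uz] Vz].
    have fz : tables k z.1 z.2 = f by rewrite /f -Uz /driver codeK.
    split; split=> //=.
      rewrite -fz ffunE /= /V2 in Vz *.
      by rewrite Vz eqxx inordK//; exact: (edge_lt eVJ).
    apply/forallP => w'; apply/implyP => ww'; rewrite -fz ffunE ifN//.
    by rewrite -[V k.+1 z.1]/(V2 k.+1 z) Vz.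
  move=> [[[Az /= Vz] /= ez] [Sz /= /forallP Qz]]; split=> //; split=> //=.
  rewrite -[RHS](decodeK nb) /driver; congr code; apply/ffunP => w'; rewrite ffunE.
  have := Qz w'; rewrite Vz; have [->|ww'] := eqVneq w' w0.
    by move=> _; rewrite /= eqxx ez inord_val.
  rewrite ifN; first by move=> /eqP.
  exact: ww'.
have -> : C `&` V2 k.+1 @^-1` [set w] = [set z | AV z.1 /\ cyl k.+1 u S z.2].
  by rewrite EC; apply/seteqP; split=> z; rewrite /AV /setI /V2 /=; tauto.
rewrite !pr_rect//; last 2 first.
- exact: measurableI.
- by apply: measurableI => //; exact: measurable_preimage_nat.
rewrite cyl_independent (edge_law_cond eVJ mVJ condVJ)// -/AV.
rewrite (table_law_prod (fun w' e => (w' != w0) ==> (e == f w'))).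
(* The entry of [xi k] at [w0] is unconstrained and sums to one; the corresponding factor of
   [table_law] comes from the path. *)
rewrite (bigD1 w0)//= [X in _ * (_ * (X * _))](_ : _ = 1); last first.
  by rewrite -[RHS](edge_law_sum1 P eVJ mVJ k w0); apply: eq_bigl => e; rewrite eqxx.
rewrite mul1r (eq_bigr (fun w' : 'I_k.+2 => edge_law P V J k w' (f w'))); last first.
  by move=> w' ww'; rewrite (big_pred1 (f w'))// => e; rewrite ww'.
by rewrite /table_law [in RHS](bigD1 w0)//= -/f; ring.
Qed.

(** Uniqueness of measures: restricting to one value of the table and scaling by its probability
    give the same finite measure on [rect k.+1], hence on the joint past. *)
Lemma driver_indep k n C : joint_filt V2 J2 driver k.+1 C ->
  pr P2 (C `&` driver k @^-1` [set n]) = pr P2 C * pr P2 (driver k @^-1` [set n]).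
Proof.
move=> /joint_rect HC; have mU := measurable_driver k n.
have [nb|bn] := ltnP n #|{: jump_table k}|; last first.
  rewrite (_ : _ @^-1` _ = set0) ?setI0 ?pr0 ?mulr0//.
  by apply/seteqP; split=> z // /= Uz; have := driver_lt k z; rewrite Uz; lia.
have rT : rect k.+1 setT by apply: (@rect_fst _ setT); exact: sigma_genT.
have q0 := table_law_ge0 k n.
have law : pr P2 (driver k @^-1` [set n]) = table_law k n.
  by have := driver_rect rT nb; rewrite setTI prT mulr1.
have cover : \bigcup_(i in [set: nat]) [set: T * Omega] = setT.
  by apply: bigcup_const; exists 0%N.
have := @g_sigma_algebra_measure_unique _ R _ (rect k.+1)
  (@rect_measurable _) (fun=> setT) (fun=> rT) cover
  (mrestr P2 mU) (mscale (NngNum q0) P2).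
move=> /(_ _ _ _ _ HC) H; rewrite law mulrC; apply: EFin_inj.
have mC := sigma_gen_measurable (@rect_measurable k.+1) HC.
rewrite EFinM -!prE//; last exact: measurableI.
apply: H.
- move=> A B [A1 [u1 [S1 [G1 ->]]]] [A2 [u2 [S2 [G2 ->]]]].
  exists (A1 `&` A2), (maxn u1 u2), (fun i m => ((i < u1) ==> S1 i m) && ((i < u2) ==> S2 i m))%N.
  split; first exact: (sigma_genI G1 G2).
  apply/seteqP; split=> z.
    move=> [[Az Sz] [Bz Tz]]; split=> // i /andP[ki iu].
    by apply/andP; split; apply/implyP => ui; [apply: Sz|apply: Tz]; rewrite ki.
  move=> [[Az Bz] Sz]; split; split=> // i /andP[ki iu].
    have /andP[/implyP] : ((i < u1)%N ==> S1 i (xi i z.2)) && ((i < u2)%N ==> S2 i (xi i z.2)).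
      by apply: Sz; lia.
    by move=> H1 _; exact: H1.
  have /andP[_ /implyP] : ((i < u1)%N ==> S1 i (xi i z.2)) && ((i < u2)%N ==> S2 i (xi i z.2)).
    by apply: Sz; lia.
  exact.
- move=> A rA; have mA := rect_measurable rA.
  transitivity (pr P2 (A `&` driver k @^-1` [set n]))%:E.
    exact: (prE P2 (measurableI _ _ mA mU)).
  rewrite (driver_rect rA nb) EFinM; congr (_ * _)%E.
  exact/esym/(prE P2 mA).
- move=> _; apply: (@le_lt_trans _ _ 1%E); last exact: ltry.
  by apply: (@probability_le1 _ _ _ P2); exact: measurableI.
Qed.

Lemma ergodic_ext : ergodic P V J -> ergodic P2 V2 J2.
Proof.
move=> erg A GA.
have fstA k : exists B, Gfilt V J k B /\ A = [set z | B z.1].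
  move: (GA k); move: A {GA}; apply: sigma_genP.
  - by exists set0; split=> //; exact: (@sigma_algebra0 _ setT).
  - by move=> A [B [GB ->]]; exists (~` B); split=> //; exact: (sigma_genC GB).
  - move=> F /choice[B HB]; exists (\bigcup_n B n); split.
      by apply: sigma_algebra_bigcup => n; exact: (HB n).1.
    by apply/seteqP; split=> z [n _]; rewrite ?(HB n).2 => Bz; exists n => //; rewrite (HB n).2.
  - move=> A [i [a [ki [->|->]]]].
      by exists (V i @^-1` [set a]); split=> //; exact: Gfilt_V.
    by exists (J i @^-1` [set a]); split=> //; exact: Gfilt_J.
have [B [GB EA]] := fstA 0%N.
(* Cutting at a point of [Omega] shows that the bases found at the various levels coincide, so [B]
   is a remote event of the original path. *)
have GBk k : Gfilt V J k B.
  have [B' [GB' EA']] := fstA k; rewrite (_ : B = B')//.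
  apply/seteqP; split=> x Bx.
    have : A (x, point) by rewrite EA.
    by rewrite EA'.
  have : A (x, point) by rewrite EA'.
  by rewrite EA.
have mB : measurable B by exact: Gfilt_measurable GB.
have -> : P2 A = P B; last exact: erg.
rewrite EA (_ : mkset _ = B `*` setT); last by apply/seteqP; split=> z; [|case].
transitivity (P B * L setT)%E; first exact: product_measure1E.
by rewrite probability_setT mule1.
Qed.

Lemma same_law_ext : same_law P V J P2 V2 J2.
Proof.
move=> N a b; have [mV mJ] := mVJ.
set A := [set x | forall k, _].
have mA : measurable A.
  rewrite (_ : A = \bigcap_(k in [set k | (k < N)%N])
      (V k @^-1` [set a k] `&` J k @^-1` [set b k])).
    by apply: bigcap_measurableType => k _; exact: measurableI.
  by apply/seteqP; split=> x Ax k /= /Ax.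
rewrite [X in _ = P2 X](_ : _ = A `*` setT); last by apply/seteqP; split=> z; [|case].
transitivity (P A * L setT)%E; last exact/esym/product_measure1E.
by rewrite probability_setT mule1.
Qed.

End extension.
End driver.

Theorem theorem7p3 (R : realType) (d : measure_display) (T : measurableType d)
  (P : probability T R) (V J : nat -> T -> nat) :
  euler_process V J ->
  proc_measurable V J ->
  ergodic P V J ->
  cond_law_hyp P V J ->
  has_generating_parameterization P V J /\ standard P V J.
Proof.
move=> eVJ mVJ erg condVJ.
(* The auxiliary tables are independent from level to level, with laws [table_law]; their space is
   then multiplied by that of the path. *)
have [d2 [Om [L [xi [mxi law_xi]]]]] := exists_independent_sequence
  (table_law_ge0 P V J) (table_law_sum1 P eVJ mVJ).
have mU := measurable_driver mVJ mxi.
have mVJ2 := proc_measurable_ext mVJ Om.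
have erg2 : ergodic (P \x L)%E _ _ := @ergodic_ext _ _ _ _ _ _ mVJ _ _ L erg.
have Vstep := V_driver eVJ xi.
have Jstep := J_driver eVJ xi.
have indep := driver_indep eVJ mVJ condVJ mxi law_xi.
have gen := driver_generating_param mVJ2 mU Vstep Jstep indep erg2.
have eVJ2 : euler_process (fun k (z : T * Om) => V k z.1) (fun k z => J k z.1).
  by move=> z; exact: eVJ.
(* The same enlarged space and the same tables serve both conclusions. *)
split; exists _, _, (P \x L)%E, (fun k z => V k z.1), (fun k z => J k z.1);
  (split; [exact: eVJ2|split; [exact: mVJ2|split; [exact: same_law_ext|]]]).
  by exists _, nat, (driver V J xi).
exists _, nat, (driver V J xi); split.
  exact: (driver_indep_family mVJ2 mU indep).
have [_ [_ [_ GU]]] := gen.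
exact: (driver_immersed mVJ2 mU Vstep Jstep indep (driver_lt V J xi) GU).
Qed.
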